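(* For every $G=G(x;y)\in\Lambda_{\mathbb{Q}}[x]\otimes\Lambda_{\mathbb{Q}}[y]$, the quantity $$\Psi_n(G)=\frac{1}{n!}\sum_{\lambda\vdash n} f_\lambda^2\,G\bigl(\{c_u : u\in\lambda\};\{\lambda_i+n-i : 1\le i\le n\}\bigr)$$ is a polynomial function of $n$ with rational coefficients; that is, there is a polynomial $P_G\in\mathbb{Q}[n]$ such that $\Psi_n(G)=P_G(n)$ for all integers $n\ge 0$.
   Context: $\Lambda_{\mathbb{Q}}[x]\otimes\Lambda_{\mathbb{Q}}[y]$ is the ring of formal power series over $\mathbb{Q}$ of bounded degree in the variables $x=(x_1,x_2,\dots)$ and $y=(y_1,y_2,\dots)$ that are symmetric in the $x$ variables and in the $y$ variables separately. $\lambda\vdash n$ means that $\lambda$ is a partition of $n$, written as $\lambda=(\lambda_1,\dots,\lambda_n)$ with $0$'s added at the end so that there are exactly $n$ parts. $u\in\lambda$ means that $u$ is a square of the Young diagram of $\lambda$; the content of the square $u$ in row $i$ and column $j$ is $c_u=j-i$. $f_\lambda$ is the number of standard Young tableaux of shape $\lambda$. In the expression $G(\{c_u\};\{\lambda_i+n-i\})$ the $n$ contents $c_u$ (as a multiset) are substituted for $n$ of the $x$ variables, the $n$ numbers $\lambda_i+n-i$ are substituted for $n$ of the $y$ variables, and all other variables are set equal to $0$. *)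

(* Defs.v *)
From mathcomp Require Import all_boot all_order all_algebra finmap.
From mathcomp Require Import boolp classical_sets functions cardinality fsbigop.
From mathcomp.multinomials Require Import monalg.

Set Implicit Arguments.
Unset Strict Implicit.
Unset Printing Implicit Defensive.

Import GRing.Theory.
Local Open Scope ring_scope.

(* Variables are indexed from 0: (m.1, m.2) encodes the monomial
   \prod_i x_i ^ (m.1 i) * \prod_i y_i ^ (m.2 i). *)
Notation monom2 := ({cmonom nat} * {cmonom nat})%type.

(* An element of Lambda_Q[x] (x) Lambda_Q[y], given by its coefficients.
   Symmetry is invariance under every pair (s, t) of permutations of the x and
   of the y variables; m' below is the image of m under (s, t). *)
Record bisymfun := BiSymFun {
  bscoef :> monom2 -> rat;
  bs_bounded_degree : exists d : nat, forall m : monom2,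
    (d < mdeg m.1 + mdeg m.2)%N -> bscoef m = 0;
  bs_symmetric : forall s t : nat -> nat, bijective s -> bijective t ->
    forall m m' : monom2,
      (forall i, m'.1 (s i) = m.1 i) -> (forall i, m'.2 (t i) = m.2 i) ->
      bscoef m' = bscoef m
}.

Definition cmonom_eval (a : nat -> rat) (m : {cmonom nat}) : rat :=
  \prod_(i <- finsupp m) a i ^+ m i.

(* G(a; b): the entries of a (resp. b) are substituted for the first size a
   x variables (resp. size b y variables), and 0 for all others; the order of
   the entries is irrelevant by symmetry.  Only finitely many terms of the sum
   are nonzero, because G has bounded degree. *)
Definition bs_eval (G : bisymfun) (a b : seq rat) : rat :=
  \sum_(m \in [set: monom2]%classic)
     G m * cmonom_eval (nth 0 a) m.1 * cmonom_eval (nth 0 b) m.2.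

Section Partitions.
Variable n : nat.

(* A partition of n padded with zeros to n parts; all parts are at most n. *)
Definition is_partition (la : n.-tuple 'I_n.+1) : bool :=
  sorted geq [seq val p | p <- la] && (\sum_(i < n) tnth la i == n)%N.

Variable la : n.-tuple 'I_n.+1.

(* Squares are (row, column), both counted from 0. *)
Definition diagram : {set 'I_n * 'I_n} := [set u : 'I_n * 'I_n | (u.2 < tnth la u.1)%N].

Definition content (u : 'I_n * 'I_n) : rat := u.2%:R - u.1%:R.

Definition contents : seq rat := [seq content u | u <- enum diagram].

(* la_i + n - i for 1 <= i <= n; the index here starts at 0. *)
Definition shifted_parts : seq rat :=
  [seq (tnth la i + n - i.+1)%N%:R | i <- enum 'I_n].

(* Entries are 0, ..., n.-1 rather than 1, ..., n.  When la is a partition of n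
   its diagram has n squares, so an injective filling uses every entry once. *)
Definition is_SYT (T : {ffun {u | u \in diagram} -> 'I_n}) : bool :=
  [&& injectiveb T,
      [forall u : {u | u \in diagram}, forall v : {v | v \in diagram},
         ((val u).1 == (val v).1) && ((val u).2 < (val v).2)%N
           ==> (T u < T v)%N] &
      [forall u : {u | u \in diagram}, forall v : {v | v \in diagram},
         ((val u).2 == (val v).2) && ((val u).1 < (val v).1)%N
           ==> (T u < T v)%N]].

Definition num_SYT : nat := #|[set T | is_SYT T]|.

End Partitions.

Definition Psi (n : nat) (G : bisymfun) : rat :=
  (n`!%:R)^-1 * \sum_(la : n.-tuple 'I_n.+1 | is_partition la)
    (num_SYT la)%:R ^+ 2 * bs_eval G (contents la) (shifted_parts la).

(* Main.v *)
Require Import Defs.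
From mathcomp Require Import all_boot all_order all_algebra finmap.
From mathcomp Require Import ring lra zify boolp fsbigop.
From mathcomp.multinomials Require Import monalg.

(** Write [E_n F] for the mean of a function [F] of partitions under the
Plancherel measure [la |-> f_la ^ 2 / n!] on partitions of [n], so that the
quantity studied is [E_n] of the values of [G].  By the branching rule
[f_mu = sum of f_la over the la obtained by removing a box of mu], the measure
of size [n + 1] arises from that of size [n] by adding one box to [la], with
probability [f_mu / ((n + 1) f_la)] of reaching [mu]
([plancherel_mean_growth]).  Hence [E_(n+1) F - E_n F = E_n (D F)], where
[D F] is the expected increment of [F] when a box is added.  If [F] lies in a
filtered algebra on which [D] strictly lowers the filtration, then induction on
the filtration and summation over [n] show that [E_n F] is a polynomial in [n]
([plancherel_mean_polynomial]).

The algebra is generated by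
[q_k la = sum_i ((la_i - i)^k - (- i)^k)], rows being numbered from 1.  These
functions do not change when zero rows are appended to [la], so the same
polynomial in the [q_k] serves for all [n] at once; [q_k] is given weight
[k + 1].  Adding a box at the end of row [i] adds [(a + 1)^k - a^k] to [q_k],
with [a = la_i - i] ([weight_increment]); so [D] is controlled by the moments of
[a] under the transition probabilities.  The formula of Frobenius for [f_la]
([frobenius_formula]) makes these probabilities the coefficients of the
partial fraction expansion of a rational function whose zeros and poles are
given by the rows of [la].  The logarithmic derivative of that function gives
a recurrence of Newton type ([interp_moment_recurrence]) from which the [k]-th
moment is a polynomial in the [q_j] of weight at most [k]
([transition_moment_weight]).  Since an increment has lost at least one unit of
weight before averaging, so has [D F].

It remains to see that the values of [G] are polynomials in the [q_k]
([bs_eval_weighted]).  A symmetric function of bounded degree is a polynomial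
in the power sums ([bs_eval_subalgebra]).  The power sums of the contents and of
the numbers [la_i + n - i] are polynomials in the [q_k], because [n = q_1] and
because sums of powers of consecutive integers are polynomials in the bounds. *)

Set Implicit Arguments.
Unset Strict Implicit.
Unset Printing Implicit Defensive.

Import Order.TTheory GRing.Theory Num.Theory.
Local Open Scope ring_scope.

(** * Moments of partial fraction coefficients *)

(** The residue at the simple pole [x i] of
[\prod_j (z - y j) / \prod_k (z - x k)]. *)
Definition interp_weight (I J : finType) (x : I -> rat) (y : J -> rat) (i : I) : rat :=
  \prod_j (x i - y j) / \prod_(k | k != i) (x i - x k).

Lemma size_prod_monic_XsubC (I : finType) (P : pred I) (x : I -> rat) :
  size (\prod_(k | P k) ('X - (x k)%:P)) = #|P|.+1.
Proof. by rewrite cardE -(size_prod_XsubC (enum P) x) big_enum. Qed.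

(** Both sides have degree less than the number of nodes and agree at each of
them. *)
Lemma lagrange_expansion (I J : finType) (x : I -> rat) (y : J -> rat) :
  injective x -> #|I| = #|J|.+1 ->
  \prod_j ('X - (y j)%:P) =
  \sum_i interp_weight x y i *: \prod_(k | k != i) ('X - (x k)%:P).
Proof.
move=> xinj cardI; apply/eqP; rewrite -subr_eq0; apply/eqP.
set p := _ - _.
have psize : (size p <= #|I|)%N.
  apply: (leq_trans (size_polyD _ _)); rewrite size_polyN geq_max; apply/andP; split.
    by rewrite size_prod_monic_XsubC cardI.
  apply: (leq_trans (size_sum _ _ _)); apply/bigmax_leqP => i _.
  apply: (leq_trans (size_scale_leq _ _)).
  by rewrite size_prod_monic_XsubC (cardC1 i) cardI.
apply: (@roots_geq_poly_eq0 _ _ (map x (enum I))).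
- apply/allP => _ /mapP[i _ ->]; rewrite /root /p hornerD hornerN horner_prod.
  rewrite horner_sum [X in _ - X](bigD1 i) //= [X in _ - (_ + X)]big1 ?addr0; last first.
    move=> k ki; rewrite hornerZ horner_prod (bigD1 i) 1?eq_sym //= .
    by rewrite hornerXsubC subrr mul0r mulr0.
  rewrite hornerZ horner_prod /interp_weight.
  under eq_bigr => j _ do rewrite hornerXsubC.
  under [in X in _ - X]eq_bigr => j _ do [].
  under [X in _ - _ * X]eq_bigr => j _ do rewrite hornerXsubC.
  rewrite divfK ?subrr //; apply/prodf_neq0 => k ki.
  by rewrite subr_eq0; apply: contra_neq ki => /xinj.
- by rewrite map_inj_uniq // enum_uniq.
- by rewrite size_map -cardE.
Qed.

Lemma poly_eq_nonzero (p q : {poly rat}) :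
  (forall u, u != 0 -> p.[u] = q.[u]) -> p = q.
Proof.
move=> pq; apply/eqP; rewrite -subr_eq0; apply/eqP.
apply: (@roots_geq_poly_eq0 _ _ [seq i.+1%:R | i <- iota 0 (size (p - q))]).
- apply/allP => _ /mapP[i _ ->]; rewrite /root hornerD hornerN pq ?subrr //.
  by rewrite pnatr_eq0.
- rewrite map_inj_uniq ?iota_uniq // => i j /eqP.
  by rewrite eqr_nat => /eqP[].
- by rewrite size_map size_iota.
Qed.

(** The previous identity read at [1 / u] and cleared of denominators: in the
variable [u] the moments of the residues become the coefficients of a power
series. *)
Lemma lagrange_expansion_rev (I J : finType) (x : I -> rat) (y : J -> rat) :
  injective x -> #|I| = #|J|.+1 ->
  \prod_j (1 - (y j)%:P * 'X) =
  \sum_i (interp_weight x y i)%:P * \prod_(k | k != i) (1 - (x k)%:P * 'X).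
Proof.
move=> xinj cardI; apply: poly_eq_nonzero => u u0.
have rev (K : finType) (P : pred K) (z : K -> rat) :
    (\prod_(k | P k) (1 - (z k)%:P * 'X)).[u] =
    u ^+ #|P| * (\prod_(k | P k) ('X - (z k)%:P)).[u^-1].
  rewrite !horner_prod -prodr_const -big_split /=; apply: eq_bigr => k _.
  by rewrite !hornerE mulrBr divff // mulrC.
rewrite rev (lagrange_expansion y xinj cardI) !horner_sum mulr_sumr; apply: eq_bigr => i _.
rewrite hornerM hornerC rev hornerZ mulrCA; congr (_ * (_ ^+ _ * _)).
have := cardC1 i; rewrite cardI /= => <-.
by apply: eq_card => k; rewrite !inE.
Qed.

(** [l] is ['X] times the logarithmic derivative of [f], as a power series
truncated at order [K]; working modulo ['X^K] avoids power series. *)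
Definition log_derivative (K : nat) (f l : {poly rat}) :=
  'X^K %| ('X * f^`() - l * f).

Lemma log_derivativeM K f g l m :
  log_derivative K f l -> log_derivative K g m -> log_derivative K (f * g) (l + m).
Proof.
rewrite /log_derivative => Hf Hg.
have -> : 'X * (f * g)^`() - (l + m) * (f * g) =
  ('X * f^`() - l * f) * g + f * ('X * g^`() - m * g) by rewrite derivM; ring.
by apply: dvdp_add; [apply: dvdp_mulr | apply: dvdp_mull].
Qed.

Lemma log_derivative_prod K (I : finType) (f l : I -> {poly rat}) :
  (forall i, log_derivative K (f i) (l i)) ->
  log_derivative K (\prod_i f i) (\sum_i l i).
Proof.
move=> fl; apply: (big_ind2 (log_derivative K)) => //.
  by rewrite /log_derivative derivC mulr0 mul0r subrr dvdp0.
by move=> *; apply: log_derivativeM.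
Qed.

Lemma dvdXnP K (f : {poly rat}) :
  reflect (forall k, (k < K)%N -> f`_k = 0) ('X^K %| f).
Proof.
apply: (iffP idP).
  by case/dvdpP => g -> k kK; rewrite coefMXn kK.
move=> f0; rewrite -[f](poly_take_drop K) (_ : take_poly K f = 0).
  by rewrite add0r dvdp_mulIr.
by apply/polyP => k; rewrite coef_take_poly coef0; case: ifP => // /f0.
Qed.

Definition geom_poly (K : nat) (a : rat) : {poly rat} := \poly_(k < K) (a ^+ k).
Definition power_poly (K : nat) (a : rat) : {poly rat} :=
  \poly_(k < K) (if k == 0%N then 0 else a ^+ k).

Lemma coef_geom_poly K a k : (k < K)%N -> (geom_poly K a)`_k = a ^+ k.
Proof. by move=> kK; rewrite coef_poly kK. Qed.

Lemma coef_power_poly K a k :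
  (k < K)%N -> (power_poly K a)`_k = if k == 0%N then 0 else a ^+ k.
Proof. by move=> kK; rewrite coef_poly kK. Qed.

Lemma log_derivative_geom K a : log_derivative K (geom_poly K a) (power_poly K a).
Proof.
apply/dvdXnP => k kK; rewrite coefB coefXM coefM big_ord_recl.
rewrite coef_power_poly /=; last exact: leq_ltn_trans kK.
rewrite mul0r add0r (eq_bigr (fun=> a ^+ k)) => [|i _]; last first.
  have iK : (lift ord0 i <= k)%N by rewrite lift0.
  rewrite coef_power_poly ?coef_geom_poly; last exact: leq_ltn_trans kK.
    by rewrite /= -exprD subnKC.
  by apply: leq_ltn_trans kK; rewrite leq_subr.
rewrite sumr_const card_ord; case: k kK => [|k] kK /=; first by rewrite subrr.
by rewrite coef_deriv coef_geom_poly // subrr.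
Qed.

Lemma log_derivative_linear K b :
  log_derivative K (1 - b%:P * 'X) (- power_poly K b).
Proof.
rewrite /log_derivative; have -> : (1 - b%:P * 'X)^`() = - b%:P.
  by rewrite derivB derivM derivX !derivC mul0r !add0r mulr1.
apply/dvdXnP => k kK.
have -> : 'X * - b%:P - - power_poly K b * (1 - b%:P * 'X) =
  power_poly K b - b%:P * 'X - b%:P * ('X * power_poly K b) by ring.
rewrite !coefB !coefCM coefX coefXM coef_power_poly //.
case: k kK => [|[|k]] kK /=; first by ring.
  by rewrite coef_power_poly ?(ltnW kK) //=; ring.
by rewrite coef_power_poly ?(ltnW kK) //= (exprS _ k.+1); ring.
Qed.

Lemma geom_polyM K a : 'X^K %| (1 - a%:P * 'X) * geom_poly K a - 1.
Proof.
apply/dvdXnP => k kK; rewrite mulrBl mul1r !coefB -mulrA coefCM coefXM coef1.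
rewrite !coef_poly kK; case: k kK => [|k] kK /=; first by rewrite mulr0 !subr0 subrr.
by rewrite (ltnW kK) exprS subrr subr0.
Qed.

(** The generating function of the moments is [B = \prod_j (1 - y_j u)] divided
by [\prod_i (1 - x_i u)].  Its logarithmic derivative is the generating function
of the differences of power sums, and comparing coefficients gives a recurrence
of the same shape as Newton's identities. *)
Lemma interp_moment_recurrence (I J : finType) (x : I -> rat) (y : J -> rat) :
  injective x -> #|I| = #|J|.+1 ->
  let M k := \sum_i interp_weight x y i * x i ^+ k in
  M 0%N = 1 /\ forall k, k%:R * M k =
    \sum_(r < k) (\sum_i x i ^+ r.+1 - \sum_j y j ^+ r.+1) * M (k - r.+1)%N.
Proof.
move=> xinj cardI M; split.
  have := congr1 (fun p : {poly rat} => p.[0]) (lagrange_expansion_rev y xinj cardI).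
  rewrite horner_prod horner_sum big1; last by move=> j _; rewrite !hornerE.
  move->; apply: eq_bigr => i _; rewrite hornerM horner_prod big1 ?hornerC ?expr0 //.
  by move=> k _; rewrite !hornerE.
move=> k; set K := k.+1.
pose B := \prod_j (1 - (y j)%:P * 'X) : {poly rat}.
pose Gm := \prod_i geom_poly K (x i).
pose Mt := \poly_(k < K) M k.
pose L := \sum_i power_poly K (x i) - \sum_j power_poly K (y j).
have HB : log_derivative K (B * Gm) L.
  rewrite /L addrC -sumrN; apply: log_derivativeM; apply: log_derivative_prod => i.
    exact: log_derivative_linear.
  exact: log_derivative_geom.
have MtE : Mt = \sum_i (interp_weight x y i)%:P * geom_poly K (x i).
  apply/polyP => j; rewrite coef_poly coef_sum.
  under [RHS]eq_bigr => i _ do rewrite coefCM coef_poly.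
  by case: ifP => // _; rewrite big1 // => i _; rewrite mulr0.
(* [Gm] is the truncated inverse of the product of the [1 - x_i u]. *)
have prod1 (P : pred I) :
    'X^K %| \prod_(i | P i) ((1 - (x i)%:P * 'X) * geom_poly K (x i)) - 1.
  apply: (big_ind (fun p => 'X^K %| p - 1)); first by rewrite subrr dvdp0.
    move=> p q Hp Hq; have -> : p * q - 1 = (p - 1) * q + (q - 1) by ring.
    by apply: dvdp_add => //; apply: dvdp_mulr.
  by move=> i _; apply: geom_polyM.
have BM : 'X^K %| B * Gm - Mt.
  rewrite /B (lagrange_expansion_rev y xinj cardI) MtE mulr_suml -sumrB.
  apply: (big_ind (fun p => 'X^K %| p)); rewrite ?dvdp0 //.
    by move=> p q; apply: dvdp_add.
  move=> i _; rewrite /Gm [\prod_j geom_poly _ _](bigD1 i) //=.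
  have factor (a A g C : {poly rat}) : a * A * (g * C) - a * g = a * g * (A * C - 1).
    by ring.
  by rewrite factor dvdp_mull // -big_split /=.
(* [Mt] inherits the relation from [B * Gm], to which it is congruent. *)
have HM : log_derivative K Mt L.
  have Xd (p : {poly rat}) : 'X^K %| p -> 'X^K %| 'X * p^`().
    move/dvdXnP => p0; apply/dvdXnP => -[|j] jK; rewrite coefXM //=.
    by rewrite coef_deriv p0 // mul0rn.
  rewrite /log_derivative.
  have -> : 'X * Mt^`() - L * Mt = ('X * (B * Gm)^`() - L * (B * Gm)) -
    ('X * (B * Gm - Mt)^`() - L * (B * Gm - Mt)) by rewrite [(_ - Mt)^`()]derivB; ring.
  by apply: dvdp_sub => //; apply: dvdp_sub; [apply: Xd | apply: dvdp_mull].
have Lr r : (r < K)%N -> L`_r = if r == 0%N then 0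
    else \sum_i x i ^+ r - \sum_j y j ^+ r.
  move=> rK; rewrite coefB !coef_sum.
  under eq_bigr do rewrite coef_power_poly //.
  under [X in _ - X]eq_bigr do rewrite coef_power_poly //.
  by case: ifP => // _; rewrite !big1 ?subrr.
have Mtk r : (r < K)%N -> Mt`_r = M r by rewrite coef_poly => ->.
have /dvdXnP/(_ k (ltnSn _))/eqP := HM.
rewrite coefB subr_eq0 coefXM coefM big_ord_recl Lr // mul0r add0r => /eqP Hk.
transitivity (\sum_(i < k) L`_(lift ord0 i) * Mt`_(k - lift ord0 i)).
  rewrite -Hk coef_deriv; have [k0|k_gt0] := posnP k; first by rewrite k0 mul0r.
  by rewrite prednK // Mtk // mulr_natl.
apply: eq_bigr => r _; rewrite lift0 Lr ?ltnS // Mtk //.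
by rewrite ltnS leq_subr.
Qed.

Lemma interp_moment12 (I J : finType) (x : I -> rat) (y : J -> rat) :
  injective x -> #|I| = #|J|.+1 ->
  let p r := \sum_i x i ^+ r - \sum_j y j ^+ r in
  \sum_i interp_weight x y i * x i = p 1%N /\
  2%:R * \sum_i interp_weight x y i * x i ^+ 2 = p 1%N ^+ 2 + p 2%N.
Proof.
move=> xinj cardI p.
pose M k := \sum_i interp_weight x y i * x i ^+ k.
have [M0 Mrec] : M 0%N = 1 /\
    forall k, k%:R * M k = \sum_(r < k) p r.+1 * M (k - r.+1)%N.
  exact: interp_moment_recurrence.
have M1 : M 1%N = p 1%N.
  by rewrite -[LHS]mul1r (Mrec 1%N) big_ord1 subnn M0 mulr1.
split; first by rewrite -M1; apply: eq_bigr => i _; rewrite expr1.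
rewrite -/(M 2%N) (Mrec 2%N) big_ord_recl big_ord1 -[(2 - _)%N]/1%N M1.
by rewrite subnn M0 mulr1 expr2.
Qed.

(** * Weights *)

(** Polynomials in variables [Q k], viewed as functions of the whole family [Q].
Generating products one variable at a time keeps every argument about them a
structural induction.  The variable [Q k] has weight [k + 1]. *)
Inductive weight_le : nat -> ((nat -> rat) -> rat) -> Prop :=
| weight_const w c : weight_le w (fun=> c)
| weight_gen v w k f : weight_le v f -> (v + k.+1 <= w)%N ->
    weight_le w (fun Q => Q k * f Q)
| weight_add w f g : weight_le w f -> weight_le w g ->
    weight_le w (fun Q => f Q + g Q).

Lemma weight_mono v w f : weight_le v f -> (v <= w)%N -> weight_le w f.
Proof.
move=> Hf; elim: Hf w => {v f} [v c|u v k f Hf IH uv|v f g _ IHf _ IHg] w vw.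
- exact: weight_const.
- exact: weight_gen Hf (leq_trans uv vw).
- by apply: weight_add; [apply: IHf | apply: IHg].
Qed.

Lemma weight_scale w c f : weight_le w f -> weight_le w (fun Q => c * f Q).
Proof.
elim=> {w f} [w d|v w k f _ IH vw|w f g _ IHf _ IHg].
- exact: weight_const.
- have -> : (fun Q => c * (Q k * f Q)) = (fun Q => Q k * (c * f Q)).
    by apply/funext => Q; ring.
  exact: weight_gen IH vw.
- have -> : (fun Q => c * (f Q + g Q)) = (fun Q => c * f Q + c * g Q).
    by apply/funext => Q; ring.
  exact: weight_add.
Qed.

Lemma weight_mul v w f g : weight_le v f -> weight_le w g ->
  weight_le (v + w) (fun Q => f Q * g Q).
Proof.
move=> Hf Hg; elim: Hf => {v f} [v c|u v k f _ IH uv|v f1 f2 _ IH1 _ IH2].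
- by apply: (@weight_mono w); [apply: weight_scale | apply: leq_addl].
- have -> : (fun Q => Q k * f Q * g Q) = (fun Q => Q k * (f Q * g Q)).
    by apply/funext => Q; ring.
  by apply: weight_gen IH _; lia.
- have -> : (fun Q => (f1 Q + f2 Q) * g Q) = (fun Q => f1 Q * g Q + f2 Q * g Q).
    by apply/funext => Q; ring.
  exact: weight_add.
Qed.

Lemma weight_sum w (I : Type) (r : seq I) (P : pred I) (F : I -> (nat -> rat) -> rat) :
  (forall i, P i -> weight_le w (F i)) ->
  weight_le w (fun Q => \sum_(i <- r | P i) F i Q).
Proof.
move=> HF; elim: r => [|i r IH].
  under eq_fun do rewrite big_nil; exact: weight_const.
under eq_fun do rewrite big_cons.
by case Pi: (P i) => //; apply: weight_add (HF i Pi) IH.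
Qed.

Lemma weight_var w k : (k < w)%N -> weight_le w (fun Q => Q k).
Proof.
move=> kw; under eq_fun do rewrite -[_ k]mulr1.
exact: (@weight_gen 0%N _ k _ (weight_const 0%N 1) kw).
Qed.

(** The same with one more variable [a], of weight 1, standing for the position
at which a box is added. *)
Inductive weight2_le : nat -> ((nat -> rat) -> rat -> rat) -> Prop :=
| weight2_base w f : weight_le w f -> weight2_le w (fun Q _ => f Q)
| weight2_step v w h : weight2_le v h -> (v < w)%N ->
    weight2_le w (fun Q a => a * h Q a)
| weight2_add w g h : weight2_le w g -> weight2_le w h ->
    weight2_le w (fun Q a => g Q a + h Q a).

Lemma weight2_mono v w h : weight2_le v h -> (v <= w)%N -> weight2_le w h.
Proof.
move=> Hh; elim: Hh w => {v h} [v f Hf|u v h Hh IH uv|v g h _ IHg _ IHh] w vw.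
- exact/weight2_base/(weight_mono Hf).
- exact: weight2_step Hh (leq_trans uv vw).
- by apply: weight2_add; [apply: IHg | apply: IHh].
Qed.

Lemma weight2_mul v w g h : weight2_le v g -> weight2_le w h ->
  weight2_le (v + w) (fun Q a => g Q a * h Q a).
Proof.
move=> Hg; elim: Hg w h => {v g} [v f Hf|u v g _ IH uv|v g1 g2 _ IH1 _ IH2] w h Hh.
- elim: Hh => {w h} [w f' Hf'|w w' h _ IH ww'|w g' h _ IHg _ IHh].
  + exact/weight2_base/weight_mul.
  + have -> : (fun Q a => f Q * (a * h Q a)) = (fun Q a => a * (f Q * h Q a)).
      by apply/funext => Q; apply/funext => a; ring.
    by apply: weight2_step IH _; lia.
  + have -> : (fun Q a => f Q * (g' Q a + h Q a)) =
              (fun Q a => f Q * g' Q a + f Q * h Q a).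
      by apply/funext => Q; apply/funext => a; ring.
    exact: weight2_add.
- have -> : (fun Q a => a * g Q a * h Q a) = (fun Q a => a * (g Q a * h Q a)).
    by apply/funext => Q; apply/funext => a; ring.
  by apply: weight2_step (IH _ _ Hh) _; lia.
- have -> : (fun Q a => (g1 Q a + g2 Q a) * h Q a) =
            (fun Q a => g1 Q a * h Q a + g2 Q a * h Q a).
    by apply/funext => Q; apply/funext => a; ring.
  by apply: weight2_add; [apply: IH1 | apply: IH2].
Qed.

Lemma weight2_linear_exp k (c : rat) : weight2_le k (fun _ a => (a + c) ^+ k).
Proof.
elim: k => [|k IH].
  under eq_fun do under eq_fun do rewrite expr0.
  exact/weight2_base/weight_const.
under eq_fun do under eq_fun do rewrite exprS.
rewrite -add1n; apply: weight2_mul IH; apply: weight2_add; last first.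
  exact/weight2_base/weight_const.
have -> : (fun (_ : nat -> rat) (a : rat) => a) = (fun _ a => a * 1).
  by apply/funext => Q; apply/funext => a; rewrite mulr1.
exact: (weight2_step (weight2_base (weight_const 0 1))).
Qed.

(** The effect on the power sums [sum_i a_i ^ k] of replacing one of the [a_i],
equal to [a], by [a + 1]. *)
Definition shift_power_sums (Q : nat -> rat) (a : rat) (k : nat) : rat :=
  Q k + ((a + 1) ^+ k - a ^+ k).

(** In the increment of a monomial at least one factor [Q k], of weight [k + 1],
is replaced by [(a + 1)^k - a^k], of weight at most [k]. *)
Lemma weight_increment w f : weight_le w f ->
  exists2 h, weight2_le w.-1 h /\ (w = 0%N -> h = fun _ _ => 0) &
    forall Q a, f (shift_power_sums Q a) = f Q + h Q a.
Proof.
elim=> {w f} [w c|v w k f Hf [h [Hh h0] fh] vw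
             |w f g _ [h [Hh h0] fh] _ [h' [Hh' h0'] gh']].
- exists (fun _ _ => 0); last by move=> *; rewrite addr0.
  by split => //; apply/weight2_base/weight_const.
- pose d a : rat := (a + 1) ^+ k - a ^+ k.
  have Hd : weight2_le k (fun _ => d).
    have -> : (fun _ : nat -> rat => d) = (fun _ a => (a + 1) ^+ k + (-1) * (a + 0) ^+ k).
      by apply/funext => _; apply/funext => a; rewrite /d addr0; ring.
    apply: weight2_add; first exact: weight2_linear_exp.
    rewrite -[k]add0n; apply: weight2_mul; last exact: weight2_linear_exp.
    exact/weight2_base/weight_const.
  exists (fun Q a => Q k * h Q a + (d a * f Q + d a * h Q a)); last first.
    by move=> Q a; rewrite fh {1}/shift_power_sums /d; ring.
  split; last by move=> w0; lia.
  apply: weight2_add; last apply: weight2_add.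
  + case: v Hf Hh h0 vw => [|v] Hf Hh h0 vw.
      rewrite h0 //; under eq_fun do under eq_fun do rewrite mulr0.
      exact/weight2_base/weight_const.
    apply: (@weight2_mono (k.+1 + v)); last by lia.
    by apply: weight2_mul => //; apply/weight2_base/weight_var.
  + apply: (@weight2_mono (k + v)); last by lia.
    by apply: weight2_mul => //; apply: weight2_base.
  + apply: (@weight2_mono (k + v.-1)); last by lia.
    exact: weight2_mul.
- exists (fun Q a => h Q a + h' Q a); last by move=> Q a; rewrite fh gh'; ring.
  split; first exact: weight2_add.
  by move=> w0; rewrite h0 // h0' // addr0.
Qed.

(** The difference of the power sums of poles and zeros for the transition
probabilities, in terms of [Q]; see [sum_transition_power]. *)
Definition transition_power_sum (Q : nat -> rat) (r : nat) : rat :=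
  (-1) ^+ r - \sum_(s < r) ('C(r, s)%:R * (-1) ^+ (r - s)) * Q s.

Definition transition_moments (Q M : nat -> rat) : Prop :=
  M 0%N = 1 /\ forall k, k%:R * M k =
    \sum_(r < k) transition_power_sum Q r.+1 * M (k - r.+1)%N.

(** The sum involves [Q s] only for [s < r]: the two terms [Q r] contributed by
poles and zeros cancel, and this is what keeps the weight at [r]. *)
Lemma weight_transition_power_sum r : weight_le r (transition_power_sum^~ r).
Proof.
have -> : transition_power_sum^~ r =
    (fun Q => (-1) ^+ r + (-1) * \sum_(s < r) ('C(r, s)%:R * (-1) ^+ (r - s)) * Q s).
  by apply/funext => Q; rewrite mulN1r.
apply: weight_add; first exact: weight_const.
apply/weight_scale/weight_sum => s _; apply: weight_scale.
exact: weight_var.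
Qed.

(** The polynomial does not depend on [M]: the recurrence determines [M] from
[Q]. *)
Lemma transition_moment_weight k : exists2 g, weight_le k g &
  forall Q M, transition_moments Q M -> M k = g Q.
Proof.
elim/ltn_ind: k => -[|k] IH.
  by exists (fun=> 1); [exact: weight_const | move=> Q M []].
have /choice[mu mu_] : forall j, exists g, (j < k.+1)%N -> weight_le j g /\
    forall Q M, transition_moments Q M -> M j = g Q.
  move=> j; case: (boolP (j < k.+1)%N) => [/IH[g Hg Mg]|_]; first by exists g.
  by exists (fun=> 0).
exists (fun Q => k.+1%:R^-1 *
    \sum_(r < k.+1) transition_power_sum Q r.+1 * mu (k - r)%N Q).
  apply/weight_scale/weight_sum => r _.
  have rk := ltn_ord r; apply: (@weight_mono (r.+1 + (k - r))); last by lia.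
  apply: weight_mul; first exact: weight_transition_power_sum.
  by have [] := mu_ (k - r)%N (leq_subr _ _).
move=> Q M HM; case: (HM) => M0 /(_ k.+1) Mrec.
apply: (@mulfI _ k.+1%:R); first by rewrite pnatr_eq0.
rewrite Mrec mulrA mulfV ?pnatr_eq0 // mul1r; apply: eq_bigr => r _; congr (_ * _).
by rewrite subSS; have [_] := mu_ (k - r)%N (leq_subr _ _); apply.
Qed.

(** Averaging replaces [a ^ j] by the [j]-th moment, of weight at most [j].  The
extra factor [a ^ k] makes the induction go through. *)
Lemma weight2_average v h : weight2_le v h -> forall k, exists2 g,
  weight_le (v + k) g & forall (I : finType) (R a : I -> rat) Q,
    transition_moments Q (fun j => \sum_i R i * a i ^+ j) ->
    \sum_i R i * (a i ^+ k * h Q (a i)) = g Q.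
Proof.
elim=> {v h} [v f Hf|u v h _ IH uv|v h1 h2 _ IH1 _ IH2] k.
- have [g Hg Mg] := transition_moment_weight k.
  exists (fun Q => f Q * g Q); first exact: weight_mul.
  move=> I R a Q HM; rewrite -(Mg _ _ HM) mulr_sumr.
  by apply: eq_bigr => i _; ring.
- have [g Hg Eg] := IH k.+1.
  exists g; first by apply: weight_mono Hg _; lia.
  move=> I R a Q HM; rewrite -(Eg _ R a) //.
  by apply: eq_bigr => i _; rewrite exprS; ring.
- have [g1 H1 E1] := IH1 k; have [g2 H2 E2] := IH2 k.
  exists (fun Q => g1 Q + g2 Q); first exact: weight_add.
  move=> I R a Q HM; rewrite -(E1 _ R a) // -(E2 _ R a) // -big_split /=.
  by apply: eq_bigr => i _; ring.
Qed.

(** * Linear extensions and increasing fillings *)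

Lemma big_tuple_cons (R : Type) (idx : R) (op : Monoid.com_law idx)
    (T : finType) n (P : pred (n.+1.-tuple T)) (F : n.+1.-tuple T -> R) :
  \big[op/idx]_(t | P t) F t =
  \big[op/idx]_x \big[op/idx]_(t : n.-tuple T | P [tuple of x :: t]) F [tuple of x :: t].
Proof.
rewrite pair_big_dep /=.
rewrite (reindex (fun p : T * n.-tuple T => [tuple of p.1 :: p.2])) //.
exists (fun t => (thead t, [tuple of behead t])) => [[x t] _|t _] /=.
  by congr (_, _); apply: val_inj.
by apply: val_inj; case/tupleP: t.
Qed.

(** A linear extension is the list of the elements of [D] from the largest entry
to the smallest, so that removing the largest entry removes the head of a
tuple. *)
Definition num_linext (T : finType) (lt : rel T) (n : nat) (D : {set T}) : nat :=
  #|[set t : n.-tuple T |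
      [&& uniq t, all (mem D) t & pairwise (fun u v => ~~ lt u v) t]]|.

(** The largest entry sits at a maximal element of [D], and the other entries form
a linear extension of the rest. *)
Lemma num_linextS (T : finType) (lt : rel T) n (D : {set T}) :
  irreflexive lt -> #|D| = n.+1 ->
  num_linext lt n.+1 D =
  (\sum_(x in D | [forall u in D, ~~ lt x u]) num_linext lt n (D :\ x))%N.
Proof.
move=> ltxx cardD; rewrite /num_linext cardsE -sum1_card big_tuple_cons.
rewrite [RHS]big_mkcond; apply: eq_bigr => x _.
have memx (t : n.-tuple T) : (x \notin t) && all (mem D) t = all (mem (D :\ x)) t.
  apply/andP/allP => [[xt /allP tD] u ut|H].
    by rewrite /= !inE [_ \in D]tD // andbT; apply: contraNneq xt => <-.
  split; first by apply/negP => /H /=; rewrite setD11.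
  by apply/allP => u /H /=; rewrite in_setD1 => /andP[].
case: ifP => [/andP[xD /forall_inP xmax]|xNmax].
  rewrite cardsE -sum1_card; apply: eq_bigl => t; rewrite !unfold_in /= xD /=.
  rewrite -!andbA -memx; case: (x \in t) => //=; first by rewrite !andbF.
  congr (_ && _); case tD: (all (mem D) t) => //=.
  suff -> : all (fun v => ~~ lt x v) t by [].
  by apply/allP => u /(allP tD) /xmax.
apply: big_pred0 => t; rewrite unfold_in /=; apply/negP.
case/and3P => /andP[xt ut] /andP[xD tD] /andP[/allP tx _].
case/negP: (negbT xNmax); rewrite xD /=; apply/forall_inP => u uD.
have [->|ux] := eqVneq u x; first by rewrite ltxx.
apply: tx; have tDx : {subset t <= D :\ x} by apply/allP; rewrite -memx xt.
have -> : (u \in t) = (u \in D :\ x); last by rewrite !inE ux.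
apply: (elimT (subset_cardP _)); last exact/subsetP.
rewrite (card_uniqP ut) size_tuple; apply/eqP.
by rewrite -eqSS -cardD (cardsD1 x) xD.
Qed.

(** To a list of the elements from largest to smallest entry corresponds the
filling that sends an element to its position counted from the end. *)
Lemma card_fillings_linext (T : finType) (lt : rel T) n (D : {set T}) :
  irreflexive lt -> #|D| = n ->
  #|[set f : {ffun {u | u \in D} -> 'I_n} | injectiveb f &&
      [forall u, forall v, lt (val u) (val v) ==> (f u < f v)%N]]| =
  num_linext lt n D.
Proof.
move=> ltxx cardD.
(* A listed element has index below [n], so the default of [insubd] is never taken. *)
pose toF (t : n.-tuple T) : {ffun {u | u \in D} -> 'I_n} :=
  [ffun u => rev_ord (insubd (cast_ord cardD (enum_rank_in (valP u) (val u)))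
                        (index (val u) t))].
have card_sig : #|{: {u | u \in D}}| = n by rewrite card_sig -cardD; apply: eq_card.
rewrite /num_linext; set A := [set f | _]; set B := [set t | _].
have BE (t : n.-tuple T) : t \in B -> [/\ uniq t, t =i D & pairwise (fun u v => ~~ lt u v) t].
  rewrite inE => /and3P[ut /allP tD pt]; split => //.
  apply: (elimT (subset_cardP _)); last exact/subsetP.
  by rewrite (card_uniqP ut) size_tuple.
have toFE t u : t \in B -> toF t u = (n - (index (val u) t).+1)%N :> nat.
  move=> /BE[ut tD _]; rewrite ffunE /= insubdK // unfold_in.
  by rewrite -{2}(size_tuple t) index_mem tD (valP u).
suff -> : A = toF @: B.
  rewrite card_in_imset // => s t sB tB /ffunP st.
  have [us sD _] := BE s sB; have [ut tD _] := BE t tB.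
  have idx u : u \in D -> index u s = index u t.
    move=> uD; have := congr1 val (st (Sub u uD)); rewrite /= !toFE //=.
    have : (index u s < n)%N by rewrite -{2}(size_tuple s) index_mem sD.
    have : (index u t < n)%N by rewrite -{2}(size_tuple t) index_mem tD.
    by lia.
  apply: eq_from_tnth => i; apply/eqP.
  have ti : tnth t i \in t by apply: mem_tnth.
  have tnthE (r : n.-tuple T) : uniq r -> index (tnth r i) r = i.
    by move=> ur; rewrite (tnth_nth (tnth t i)) index_uniq // size_tuple.
  have := idx (tnth t i); rewrite -tD ti tnthE // => /(_ isT) si.
  by rewrite (tnth_nth (tnth t i)) -si nth_index // sD -tD.
apply/setP => f; apply/idP/imsetP => [|[t tB ->]].
  rewrite inE => /andP[/injectiveP finj /forallP fmono].
  have [g fK gK] : bijective f by apply: inj_card_bij => //; rewrite card_ord card_sig.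
  pose t := [tuple val (g (rev_ord k)) | k < n].
  have tnthk k : tnth t k = val (g (rev_ord k)) by rewrite tnth_mktuple.
  have ut : uniq t.
    rewrite map_inj_uniq ?enum_uniq // => i j /val_inj /(can_inj gK).
    exact: rev_ord_inj.
  have idx u : index (val u) t = rev_ord (f u).
    have -> : val u = tnth t (rev_ord (f u)) by rewrite tnthk rev_ordK fK.
    by rewrite (tnth_nth (val u)) index_uniq // size_tuple.
  have tB : t \in B.
    rewrite inE ut /=; apply/andP; split.
      by apply/allP => _ /mapP[k _ ->] /=; apply: valP.
    have : pairwise (relpre val ltn) (enum 'I_n).
      rewrite -pairwise_map val_enum_ord -sorted_pairwise ?iota_ltn_sorted //.
      exact: ltn_trans.
    rewrite pairwise_map; apply: sub_pairwise => i j /= ij; apply/negP => lij.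
    have /forallP/(_ (g (rev_ord j)))/implyP/(_ lij) := fmono (g (rev_ord i)).
    by rewrite !gK /=; have := ltn_ord j; lia.
  exists t => //; apply/ffunP => u; apply: val_inj => /=.
  by rewrite toFE // idx /=; case: (f u) => k /= kn; lia.
have [ut tD pt] := BE t tB.
have idxlt u : u \in D -> (index u t < n)%N.
  by move=> uD; rewrite -{2}(size_tuple t) index_mem tD.
have subn_inj a b : (a < n)%N -> (b < n)%N -> (n - a.+1 = n - b.+1)%N -> a = b by lia.
have subn_lt a b : (a < n)%N -> (b < a)%N -> (n - a.+1 < n - b.+1)%N by lia.
rewrite inE; apply/andP; split.
  apply/injectiveP => u v /(congr1 (@nat_of_ord n)); rewrite !toFE // => uv.
  apply/val_inj; rewrite -[LHS](nth_index (val u) (s := t)) ?tD ?(valP u) //.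
  rewrite -[RHS](nth_index (val u) (s := t)) ?tD ?(valP v) //; congr nth.
  exact: subn_inj (idxlt _ (valP u)) (idxlt _ (valP v)) uv.
apply/forallP => u; apply/forallP => v; apply/implyP => luv; rewrite !toFE //.
have := idxlt _ (valP u); have := idxlt _ (valP v) => iv iu.
apply: subn_lt => //.
rewrite ltnNge; apply/negP; rewrite leq_eqVlt => /orP[/eqP e|lti].
  have uv : val u = val v.
    rewrite -[LHS](nth_index (val u) (s := t)) ?tD ?(valP u) // e.
    by rewrite (nth_index (val u) (s := t)) ?tD ?(valP v).
  by rewrite uv ltxx in luv.
have /(pairwiseP (val u))/(_ _ _ _ _ lti) := pt.
rewrite !inE !size_tuple iu iv => /(_ isT isT).
by rewrite !nth_index ?tD ?(valP u) ?(valP v) // luv.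
Qed.

(** * The Frobenius formula *)

Definition nonincreasing N (la : 'I_N -> nat) : bool :=
  [forall i : 'I_N, forall j : 'I_N, (i <= j)%N ==> (la j <= la i)%N].

Definition add_box N (la : 'I_N -> nat) (i j : 'I_N) : nat := (la j + (j == i))%N.
Definition remove_box N (la : 'I_N -> nat) (i j : 'I_N) : nat := (la j - (j == i))%N.

(** The numbers [la_i + N - i] of the usual notation, with rows counted from 0. *)
Definition beta N (la : 'I_N -> nat) (i : 'I_N) : nat := (la i + (N - i.+1))%N.

Definition vandermonde N (x : 'I_N -> rat) : rat :=
  \prod_(i < N) \prod_(j < N | (i < j)%N) (x i - x j).

(** The number of standard tableaux of shape [la], divided by the factorial of
the size: see [frobenius_formula]. *)
Definition frobenius N (la : 'I_N -> nat) : rat :=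
  vandermonde (fun i => (beta la i)%:R) / \prod_i (beta la i)`!%:R.

Lemma nonincreasingP N (la : 'I_N -> nat) :
  reflect (forall i j : 'I_N, (i <= j)%N -> (la j <= la i)%N) (nonincreasing la).
Proof.
apply: (iffP forallP) => [H i j ij|H i].
  by have /forallP/(_ j)/implyP/(_ ij) := H i.
by apply/forallP => j; apply/implyP/H.
Qed.

Lemma beta_decreasing N (la : 'I_N -> nat) : nonincreasing la ->
  forall i j : 'I_N, (i < j)%N -> (beta la j < beta la i)%N.
Proof.
move=> /nonincreasingP H i j ij; rewrite /beta; have := H i j (ltnW ij).
by have := ltn_ord j; lia.
Qed.

Lemma beta_inj N (la : 'I_N -> nat) : nonincreasing la ->
  injective (fun i => (beta la i)%:R : rat).
Proof.
move=> H i j /eqP; rewrite eqr_nat => /eqP bij; apply: val_inj => /=.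
have D := beta_decreasing H.
by have [/D|/D|//] := ltngtP i j; lia.
Qed.

Lemma vandermonde_eq0 N (x : 'I_N -> rat) i j : i != j -> x i = x j -> vandermonde x = 0.
Proof.
move=> ij xij; wlog lij : i j ij xij / (i < j)%N => [H|].
  have [lij|lji|/val_inj eij] := ltngtP i j; first exact: (H i j).
    by apply: (H j i); rewrite // eq_sym.
  by rewrite eij eqxx in ij.
by rewrite /vandermonde (bigD1 i) //= (bigD1 j) //= xij subrr !mul0r.
Qed.

(** When only one of the [N] values changes, the ratio of two Vandermonde products
reduces to the factors involving that value. *)
Lemma prod_pairs_at N (g : 'I_N -> 'I_N -> rat) (i : 'I_N) :
  (forall j k, g j k = g k j) -> (forall j k, j != i -> k != i -> j != k -> g j k = 1) ->
  \prod_(j < N) \prod_(k < N | (j < k)%N) g j k = \prod_(k | k != i) g i k.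
Proof.
move=> gC g1; rewrite (bigD1 i) //= [RHS](bigID (fun k : 'I_N => (i < k)%N)) /=.
congr (_ * _).
  by apply: eq_bigl => k; rewrite andbC -(inj_eq val_inj) /=; case: ltngtP.
rewrite [RHS]big_mkcondr /=; apply: eq_bigr => j ji.
have nij : (j : nat) != i by [].
rewrite -leqNgt leq_eqVlt (negbTE nij) /=; case: ltnP => lji.
  rewrite (bigD1 i) //= big1 ?mulr1 1?gC // => k /andP[jk ki].
  by apply: g1 => //; rewrite neq_ltn jk.
rewrite big1 // => k jk; apply: g1 => //; last by rewrite neq_ltn jk.
by apply/eqP => ki; move: jk; rewrite ki; lia.
Qed.

Lemma vandermonde_shift N (x y : 'I_N -> rat) (i : 'I_N) :
  injective x -> (forall j, j != i -> y j = x j) ->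
  vandermonde y = vandermonde x * \prod_(j | j != i) ((y i - x j) / (x i - x j)).
Proof.
move=> xinj yx.
have x0 j k : j != k -> x j - x k != 0.
  by move=> jk; rewrite subr_eq0; apply: contra_neq jk => /xinj.
have -> : \prod_(j | j != i) ((y i - x j) / (x i - x j)) =
          \prod_(j | j != i) ((y i - y j) / (x i - x j)).
  by apply: eq_bigr => j /yx ->.
rewrite -(prod_pairs_at (g := fun j k => (y j - y k) / (x j - x k))).
- rewrite /vandermonde -big_split; apply: eq_bigr => j _ /=.
  rewrite -big_split; apply: eq_bigr => k jk /=.
  by rewrite mulrCA mulfV ?mulr1 // x0 // neq_ltn jk.
- by move=> j k; rewrite -(opprB (y k)) -(opprB (x k)) invrN mulrNN.
- by move=> j k ji ki jk; rewrite !yx // mulfV // x0.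
Qed.

Lemma frobenius_add_box N (la : 'I_N -> nat) (i : 'I_N) : nonincreasing la ->
  frobenius (add_box la i) = frobenius la *
    (\prod_(j | j != i) (((beta la i)%:R + 1 - (beta la j)%:R) /
                         ((beta la i)%:R - (beta la j)%:R)) / ((beta la i)%:R + 1)).
Proof.
move=> H; have bi : beta (add_box la i) i = (beta la i).+1.
  by rewrite /beta /add_box eqxx; lia.
have bj j : j != i -> beta (add_box la i) j = beta la j.
  by move=> ji; rewrite /beta /add_box (negbTE ji) addn0.
rewrite /frobenius.
rewrite (vandermonde_shift (y := fun j => (beta (add_box la i) j)%:R)
  (i := i) (beta_inj H)); last by move=> j /bj /= ->.
rewrite [\prod_j _`!%:R](bigD1 i) //= [\prod_j (beta la j)`!%:R](bigD1 i) //= bi.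
have -> : \prod_(j | j != i) (beta (add_box la i) j)`!%:R =
          \prod_(j | j != i) (beta la j)`!%:R :> rat.
  by apply: eq_bigr => j /bj ->.
rewrite factS natrM -[(beta la i).+1]addn1 natrD !invfM.
ring.
Qed.

Lemma frobenius_remove_box N (la : 'I_N -> nat) (i : 'I_N) :
  nonincreasing la -> (0 < la i)%N ->
  frobenius (remove_box la i) = frobenius la *
    ((beta la i)%:R * \prod_(j | j != i) (((beta la i)%:R - 1 - (beta la j)%:R) /
                         ((beta la i)%:R - (beta la j)%:R))).
Proof.
move=> H lai; have bi : (beta (remove_box la i) i).+1 = beta la i.
  by rewrite /beta /remove_box eqxx; lia.
have bj j : j != i -> beta (remove_box la i) j = beta la j.
  by move=> ji; rewrite /beta /remove_box (negbTE ji) subn0.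
rewrite /frobenius.
rewrite (vandermonde_shift (y := fun j => (beta (remove_box la i) j)%:R)
  (i := i) (beta_inj H)); last by move=> j /bj /= ->.
rewrite [\prod_j _`!%:R](bigD1 i) //= [\prod_j (beta la j)`!%:R](bigD1 i) //= -bi.
have -> : \prod_(j | j != i) (beta (remove_box la i) j)`!%:R =
          \prod_(j | j != i) (beta la j)`!%:R :> rat.
  by apply: eq_bigr => j /bj ->.
set b := beta _ _.
rewrite factS natrM -[b.+1]addn1 natrD addrK !invfM.
have b1 : b%:R + 1 != 0 :> rat by rewrite -(natrD _ b 1) addn1 pnatr_eq0.
by rewrite -[LHS]mulr1 -[X in _ * X = _](mulVf b1); ring.
Qed.

Lemma frobenius_beta_eq0 N (la : 'I_N -> nat) (i j : 'I_N) :
  i != j -> beta la i = beta la j -> frobenius la = 0.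
Proof.
by move=> ij bij; rewrite /frobenius (vandermonde_eq0 ij) ?mul0r ?bij.
Qed.

(** If [la] with a box added to row [i] is not a partition, then row [i - 1] has
the length that row [i] had, and two beta numbers become equal. *)
Lemma frobenius_add_box_eq0 N (la : 'I_N -> nat) (i : 'I_N) :
  nonincreasing la -> ~~ nonincreasing (add_box la i) -> frobenius (add_box la i) = 0.
Proof.
move=> /nonincreasingP H /forallPn[j /forallPn[k]].
rewrite negb_imply -ltnNge => /andP[jk].
rewrite /add_box => lajk; have lajk' := H j k jk.
have ki : k == i by case: eqP lajk => // _; case: eqP; lia.
have ji : (j == i) = false by move: lajk; case: eqP => //; lia.
move: lajk; rewrite ki ji (eqP ki) => lajk.
have i0 : (0 < i)%N.
  by move: ji jk; rewrite (eqP ki) -(inj_eq val_inj) /=; case: (i : nat) => //; lia.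
have pN : (i.-1 < N)%N by have := ltn_ord i; lia.
pose p := Ordinal pN.
have jp : (j <= p)%N by move: ji jk; rewrite (eqP ki) -(inj_eq val_inj) /=; lia.
have pi : (p == i) = false by rewrite -(inj_eq val_inj) /=; lia.
apply: (@frobenius_beta_eq0 _ _ p i); first by rewrite pi.
rewrite /beta pi eqxx /=.
have := H j p jp; have := H p i; rewrite /=; have := ltn_ord i.
move: lajk' lajk; rewrite (eqP ki); lia.
Qed.

(** Likewise rows [i] and [i + 1] of [la] have the same length, and two beta
numbers become equal. *)
Lemma frobenius_remove_box_eq0 N (la : 'I_N -> nat) (i : 'I_N) :
  nonincreasing la -> (0 < la i)%N -> ~~ nonincreasing (remove_box la i) ->
  frobenius (remove_box la i) = 0.
Proof.
move=> /nonincreasingP H lai /forallPn[j /forallPn[k]].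
rewrite negb_imply -ltnNge => /andP[jk].
rewrite /remove_box => lajk; have lajk' := H j k jk.
have ji : j == i by case: eqP lajk => // _; case: eqP; lia.
have ki : (k == i) = false.
  move: lajk; rewrite ji; case: eqP => // ->.
  by rewrite (eqP ji); lia.
move: lajk; rewrite ki ji (eqP ji) => lajk.
have ik : (i < k)%N.
  by move: ki jk; rewrite (eqP ji) -(inj_eq val_inj) /=; lia.
have pN : (i.+1 < N)%N by have := ltn_ord k; lia.
pose p := Ordinal pN.
have pi : (p == i) = false by rewrite -(inj_eq val_inj) /=; lia.
apply: (@frobenius_beta_eq0 _ _ p i); first by rewrite pi.
rewrite /beta pi eqxx /=.
have := H p k ik; have := H i p (leqnSn _); rewrite /=.
move: lajk' lajk; rewrite (eqP ji); lia.
Qed.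

(** The factor by which the Vandermonde product of [b] is multiplied when [b i] is
increased by [t]. *)
Definition shift_weight N (b : 'I_N -> rat) (t : rat) (i : 'I_N) : rat :=
  \prod_(j | j != i) ((b i + t - b j) / (b i - b j)).

Lemma prod_shift_weight N (b : 'I_N -> rat) (t : rat) (i : 'I_N) :
  \prod_(j | j != i) (b i + t - b j) / \prod_(j | j != i) (b i - b j) = shift_weight b t i.
Proof. by rewrite /shift_weight big_split /= prodfV. Qed.

Lemma big_option (R : Type) (idx : R) (op : Monoid.com_law idx) (I : finType)
    (P : pred (option I)) (F : option I -> R) :
  \big[op/idx]_(o | P o) F o =
  op (if P None then F None else idx) (\big[op/idx]_(i | P (Some i)) F (Some i)).
Proof.
rewrite big_mkcond (bigD1 None) //=; congr (op _ _).
rewrite (reindex_omap Some id) => [|[]//].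
rewrite [RHS]big_mkcond; apply: eq_bigl => i.
by rewrite eqxx.
Qed.

(** An extra node [t], indexed by [None].  Interpolation needs one more node than
zeros, and the zeros used below are translates of the nodes [b i]. *)
Definition with_node (I : Type) (t : rat) (b : I -> rat) (o : option I) : rat :=
  if o is Some i then b i else t.

Lemma with_node_inj (I : eqType) t (b : I -> rat) :
  injective b -> (forall i, b i != t) -> injective (with_node t b).
Proof.
move=> binj bt [i|] [j|] //=; first by move/binj->.
  by move/eqP; rewrite (negbTE (bt i)).
by move/esym/eqP; rewrite (negbTE (bt j)).
Qed.

Lemma interp_weight_with_node N (b : 'I_N -> rat) (s t : rat) (i : 'I_N) :
  interp_weight (with_node t b) (fun j => b j - s) (Some i) =
  s * shift_weight b s i / (b i - t).
Proof.
rewrite /interp_weight -prod_shift_weight [in X in _ / X]big_option /=.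
rewrite (bigD1 i) //= opprB addrC subrK.
under eq_bigr => j _ do rewrite opprB addrA.
rewrite invfM; ring.
Qed.

Lemma sum_staircase N : 2%:R * (\sum_(i < N) (N - i.+1))%:R = N%:R * (N%:R - 1) :> rat.
Proof.
rewrite (reindex_inj rev_ord_inj) /=.
rewrite (eq_bigr (fun i : 'I_N => i : nat)) => [|i _]; last first.
  by have := ltn_ord i; lia.
elim: N => [|N IH]; first by rewrite big_ord0 mul0r mulr0.
by rewrite big_ord_recr /= natrD mulrDr IH -[N.+1]addn1 natrD; ring.
Qed.

(** With the extra node [-1] the sum is, up to sign, the sum of the first two
moments: the factor [x (x + 1)] kills the contribution of the extra node and
cancels the denominators at the others. *)
Lemma shift_weight_sum N (la : 'I_N -> nat) : nonincreasing la ->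
  \sum_i (beta la i)%:R * shift_weight (fun i => (beta la i)%:R) (-1) i =
  (\sum_i la i)%:R :> rat.
Proof.
move=> H; set b := fun i : 'I_N => (beta la i)%:R : rat.
have bt i : b i != -1.
  by rewrite -subr_eq0 opprK /b -(natrD _ _ 1) addn1 pnatr_eq0.
have [] := @interp_moment12 _ _ (with_node (-1) b) (fun j => b j - (-1))
  (with_node_inj (beta_inj H) bt).
  by rewrite card_option.
rewrite !big_option /= !expr1.
under eq_bigr do rewrite interp_weight_with_node.
under [X in _ -> 2%:R * (_ + X) = _ -> _]eq_bigr do rewrite interp_weight_with_node.
set R0 := interp_weight _ _ _ => M1 M2.
have -> : \sum_i b i * shift_weight b (-1) i = -
  ((R0 * (-1) + \sum_i -1 * shift_weight b (-1) i / (b i - -1) * b i) +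
   (R0 * (-1) ^+ 2 + \sum_i -1 * shift_weight b (-1) i / (b i - -1) * b i ^+ 2)).
  rewrite addrACA -big_split /= sqrrN expr1n mulr1 mulrN1 addNr add0r -sumrN.
  apply: eq_bigr => i _; have bt' : b i - -1 != 0 by rewrite subr_eq0.
  rewrite -[LHS]mulr1 -[X in _ * X = _](mulVf bt'); ring.
apply: (@mulfI _ 2%:R) => //; rewrite mulrN mulrDr M2 M1.
have -> : \sum_i (b i - -1) = \sum_i b i + N%:R.
  by rewrite big_split /= sumr_const card_ord opprK.
have -> : \sum_i (b i - -1) ^+ 2 = \sum_i b i ^+ 2 + 2%:R * \sum_i b i + N%:R.
  have -> : N%:R = \sum_(i < N) 1 :> rat by rewrite sumr_const card_ord.
  rewrite mulr_sumr -!big_split /=.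
  by apply: eq_bigr => i _; ring.
have -> : \sum_i b i = (\sum_i la i)%:R + (\sum_(i < N) (N - i.+1))%:R.
  by rewrite -natrD -big_split /= natr_sum.
have := sum_staircase N; lra.
Qed.

(** Terms on the left whose box cannot be removed vanish, either because two beta
numbers become equal or, for an empty last row, because its beta number is 0. *)
Lemma frobenius_branching N (la : 'I_N -> nat) : nonincreasing la ->
  (\sum_i la i)%:R * frobenius la =
  \sum_(i | (0 < la i)%N && nonincreasing (remove_box la i)) frobenius (remove_box la i).
Proof.
move=> H; rewrite -(shift_weight_sum H) mulr_suml [RHS]big_mkcond /=.
apply: eq_bigr => i _; have [lai|] := posnP (la i); last first.
  move=> lai /=; rewrite /shift_weight mulrC -(frobenius_remove_box H lai).
  by case: ifP => // /negbT /(frobenius_remove_box_eq0 H lai).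
have [iN|iN] := eqVneq i.+1 N.
  by rewrite /= {1}/beta lai iN subnn mul0r mul0r.
have pN : (i.+1 < N)%N by have := ltn_ord i; lia.
have lap : la (Ordinal pN) = 0%N.
  by have /nonincreasingP/(_ i (Ordinal pN) (leqnSn _)) := H; rewrite lai; lia.
have pi : Ordinal pN != i by rewrite -(inj_eq val_inj) /=; lia.
rewrite /shift_weight (bigD1 (Ordinal pN)) //=.
rewrite (_ : (beta la i)%:R + -1 - (beta la (Ordinal pN))%:R = 0).
  by rewrite mul0r mul0r mulr0 mul0r.
rewrite /beta lai lap !add0n /=; have -> : (N - i.+1 = (N - i.+2).+1)%N by lia.
by rewrite -natr1; ring.
Qed.

(** Standard tableaux are the fillings that increase along this relation, which
compares cells of one row or one column only and so is not transitive. *)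
Definition tableau_order (N : nat) (u v : 'I_N * 'I_N) : bool :=
  ((u.1 == v.1) && (u.2 < v.2)%N) || ((u.2 == v.2) && (u.1 < v.1)%N).

Definition young N (la : 'I_N -> nat) : {set 'I_N * 'I_N} :=
  [set u : 'I_N * 'I_N | (u.2 < la u.1)%N].

Lemma tableau_order_irr N : irreflexive (@tableau_order N).
Proof. by move=> u; rewrite /tableau_order !ltnn !andbF. Qed.

Lemma card_young N (la : 'I_N -> nat) : (forall i, la i <= N)%N ->
  #|young la| = (\sum_i la i)%N.
Proof.
move=> laN; rewrite cardsE -sum1_card.
rewrite (eq_bigl (fun u : 'I_N * 'I_N => true && (u.2 < la u.1)%N)) //.
rewrite -(pair_big_dep xpredT (fun i j : 'I_N => (j < la i)%N) (fun _ _ => 1%N)) /=.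
apply: eq_bigr => i _.
rewrite -(big_ord_widen N (fun=> 1%N) (laN i)).
by rewrite sum1_card card_ord.
Qed.

(** Maximal cells are the corners: ends of rows whose removal leaves a
partition. *)
Lemma young_maximal N (la : 'I_N -> nat) (i j : 'I_N) :
  nonincreasing la -> (forall i, la i <= N)%N ->
  ((i, j) \in young la) && [forall u in young la, ~~ tableau_order (i, j) u] =
  (la i == j.+1) && nonincreasing (remove_box la i).
Proof.
move=> /nonincreasingP H laN; apply/andP/andP => [[]|[/eqP laij]].
  rewrite inE /= => jla /forall_inP maxij.
  have lai : la i = j.+1.
    apply/eqP; rewrite eqn_leq jla andbT leqNgt; apply/negP => jla'.
    have jN : (j.+1 < N)%N by apply: leq_trans jla' (laN i).
    have := maxij (i, Ordinal jN); rewrite inE /= => /(_ jla') /negP; apply.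
    by rewrite /tableau_order /= eqxx ltnSn.
  split; first by rewrite lai.
  apply/nonincreasingP => k l kl; rewrite /remove_box.
  have := H k l kl; case: (eqVneq k i) => [ki|_]; last by lia.
  case: (eqVneq l i) => [->|li]; first by rewrite ki.
  have il : (i < l)%N by move: li; rewrite -ki -(inj_eq val_inj) /=; lia.
  have : ~~ (j < la l)%N.
    apply/negP => jl; have := maxij (l, j); rewrite inE /= => /(_ jl) /negP; apply.
    by rewrite /tableau_order /= eqxx il orbT.
  by rewrite ki lai; lia.
move=> /nonincreasingP H'; split; first by rewrite inE /= laij.
apply/forall_inP => -[k l]; rewrite inE /= => lla; apply/negP.
case/orP => /andP[/= /eqP e]; first by move: lla; rewrite -e laij; lia.
move=> ik; have := H' i k (ltnW ik); rewrite /remove_box eqxx laij.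
have -> : (k == i) = false by rewrite -(inj_eq val_inj) /=; lia.
by move: lla; rewrite -e; lia.
Qed.

Lemma young_remove_box N (la : 'I_N -> nat) (i j : 'I_N) : la i = j.+1 ->
  young la :\ (i, j) = young (remove_box la i).
Proof.
move=> laij; apply/setP => -[k l]; rewrite !inE /remove_box /= -pair_eqE /=.
have [->|ki] := eqVneq k i; last by rewrite subn0.
by rewrite laij -(inj_eq val_inj) /= subn1 /=; lia.
Qed.

Lemma num_linext_young_branching N (la : 'I_N -> nat) m :
  nonincreasing la -> (forall i, la i <= N)%N -> (\sum_i la i = m.+1)%N ->
  num_linext (@tableau_order N) m.+1 (young la) =
  (\sum_(i | (0 < la i)%N && nonincreasing (remove_box la i))
     num_linext (@tableau_order N) m (young (remove_box la i)))%N.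
Proof.
move=> H laN sla; rewrite num_linextS ?card_young //; last exact: tableau_order_irr.
transitivity (\sum_(i < N)
    \sum_(j < N | (la i == j.+1) && nonincreasing (remove_box la i))
      num_linext (@tableau_order N) m (young la :\ (i, j)))%N.
  rewrite pair_big_dep; apply: eq_big => [[i j]|[i j] _] //=.
  exact: young_maximal.
rewrite [RHS]big_mkcond; apply: eq_bigr => i _.
have [lai|lai] := posnP (la i).
  by rewrite big1 // => j; rewrite lai.
have jN : ((la i).-1 < N)%N by have := laN i; lia.
have [ni|ni] := boolP (nonincreasing _); last first.
  by rewrite big1 // => j; rewrite andbF.
rewrite (big_pred1 (Ordinal jN)) /=; first by rewrite young_remove_box //= prednK.
by move=> j /=; rewrite andbT -(inj_eq val_inj) /=; lia.
Qed.

Lemma remove_box_sum N (la : 'I_N -> nat) i m : (0 < la i)%N ->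
  (\sum_i la i = m.+1)%N -> (\sum_j remove_box la i j = m)%N.
Proof.
move=> lai; rewrite (bigD1 i) //= [in X in _ -> X](bigD1 i) //= /remove_box eqxx.
rewrite [in X in _ -> X](eq_bigr la); last by move=> j /negbTE->; rewrite subn0.
by lia.
Qed.

(** For the empty partition the differences of beta numbers are those of
[N - 1, ..., 0], and the ones involving row [i] and the later rows multiply to
[(N - i - 1)!]. *)
Lemma frobenius0 N (la : 'I_N -> nat) : (forall i, la i = 0%N) -> frobenius la = 1.
Proof.
move=> la0; rewrite /frobenius -prodfV -big_split /=; apply: big1 => i _.
have b j : beta la j = (N - j.+1)%N by rewrite /beta la0.
have -> : \prod_(j < N | (i < j)%N) ((beta la i)%:R - (beta la j)%:R) =
    \prod_(j < N | (i < j)%N) (j - i)%:R :> rat.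
  apply: eq_bigr => j ij; rewrite !b -natrB; last by have := ltn_ord j; lia.
  by congr _%:R; have := ltn_ord j; lia.
rewrite b -natr_prod (_ : \prod_(j < N | (i < j)%N) (j - i) = (N - i.+1)`!)%N.
  by rewrite mulfV // pnatr_eq0 -lt0n fact_gt0.
rewrite fact_prod big_add1 /= big_mkord.
have := ltn_ord i; move: (i : nat) => k kN.
rewrite -(big_mkord (fun j => k < j)%N (fun j => j - k)%N) -{1}(subnKC kN).
rewrite /index_iota subn0 iotaD big_cat /= big1_seq ?mul1n; last first.
  by move=> j; rewrite -[_ :: _]/(iota 0 k.+1) mem_iota; lia.
rewrite add0n -[in iota k.+1 _](addn0 k.+1) iotaDl big_map -(big_mkord xpredT succn).
rewrite /index_iota subn0 addn0; apply: eq_big => [j|j _]; lia.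
Qed.

(** Both sides satisfy the same branching rule. *)
Theorem frobenius_formula N (la : 'I_N -> nat) m :
  nonincreasing la -> (forall i, la i <= N)%N -> (\sum_i la i = m)%N ->
  (num_linext (@tableau_order N) m (young la))%:R = m`!%:R * frobenius la.
Proof.
elim: m la => [|m IH] la H laN sla.
  have la0 i : la i = 0%N.
    by apply/eqP; have /eqP := sla; rewrite sum_nat_eq0 => /forallP/(_ i).
  rewrite frobenius0 // /num_linext (eq_card1 (x := [tuple])) ?mulr1 //.
  by move=> t; rewrite !inE tuple0.
rewrite num_linext_young_branching // factS natrM mulrAC -sla frobenius_branching //.
rewrite natr_sum mulrC mulr_sumr; apply: eq_bigr => i /andP[lai ni].
apply: IH => //; last exact: remove_box_sum.
by move=> j; apply: leq_trans (leq_subr _ _) (laN j).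
Qed.

(** * Plancherel growth *)

(** The content of the last box of row [i], so that a box added to the row has
content [row_end la i + 1]; for an empty row, that of the cell left of it. *)
Definition row_end N (la : 'I_N -> nat) (i : 'I_N) : rat := (la i)%:R - i.+1%:R.

(** Subtracting the value for an empty row makes the sum independent of the
number of zero rows. *)
Definition box_power_sum N (la : 'I_N -> nat) (k : nat) : rat :=
  \sum_(i < N) (row_end la i ^+ k - (- i.+1%:R) ^+ k).

(** The ratio [f_mu / ((n + 1) f_la)], where [mu] is [la] with a box added to row
[i] and [n] is the size of [la]. *)
Definition transition_prob N (la : 'I_N -> nat) (i : 'I_N) : rat :=
  shift_weight (fun i => (beta la i)%:R) 1 i / ((beta la i)%:R + 1).

Lemma row_endE N (la : 'I_N -> nat) i : row_end la i = (beta la i)%:R - N%:R.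
Proof.
by rewrite /row_end /beta natrD natrB ?ltn_ord //; ring.
Qed.

Lemma box_power_sum_add_box N (la : 'I_N -> nat) i :
  box_power_sum (add_box la i) = shift_power_sums (box_power_sum la) (row_end la i).
Proof.
apply/funext => k; rewrite /box_power_sum /shift_power_sums.
rewrite (bigD1 i) //= [in RHS](bigD1 i) //=.
rewrite (eq_bigr (fun j : 'I_N => row_end la j ^+ k - (- j.+1%:R) ^+ k)); last first.
  by move=> j ji; rewrite /row_end /add_box (negbTE ji) addn0.
have -> : row_end (add_box la i) i = row_end la i + 1.
  by rewrite /row_end /add_box eqxx addn1 -natr1; ring.
ring.
Qed.

(** By the binomial theorem the sum over [s] in [transition_power_sum] is a
difference between the powers of [x - 1] and of [x]; the part coming from the
empty rows telescopes. *)
Lemma sum_transition_power N (la : 'I_N -> nat) r :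
  (- N%:R - 1) ^+ r + \sum_i row_end la i ^+ r - \sum_i (row_end la i - 1) ^+ r =
  transition_power_sum (box_power_sum la) r.
Proof.
have binom (x : rat) :
    \sum_(s < r) 'C(r, s)%:R * (-1) ^+ (r - s) * x ^+ s = (x - 1) ^+ r - x ^+ r.
  rewrite [x - 1]addrC exprDn big_ord_recr /= subnn mul1r binn mulr1n addrK.
  by apply: eq_bigr => s _; rewrite -[RHS]mulr_natl mulrA.
have tele : \sum_(i < N) ((- i.+1%:R - 1) ^+ r - (- i.+1%:R) ^+ r) =
    (- N%:R - 1) ^+ r - (-1) ^+ r :> rat.
  elim: N {la} => [|n IH]; first by rewrite big_ord0 oppr0 add0r subrr.
  rewrite big_ord_recr /= IH -[n.+1]addn1 natrD opprD addrC addrA subrK //.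
rewrite /transition_power_sum /box_power_sum.
have -> : \sum_(s < r) 'C(r, s)%:R * (-1) ^+ (r - s) *
      \sum_(i < N) (row_end la i ^+ s - (- i.+1%:R) ^+ s) =
    \sum_(i < N) (((row_end la i - 1) ^+ r - row_end la i ^+ r) -
                   ((- i.+1%:R - 1) ^+ r - (- i.+1%:R) ^+ r)).
  under eq_bigr do rewrite mulr_sumr.
  rewrite exchange_big; apply: eq_bigr => i _ /=; rewrite -!binom -sumrB.
  by apply: eq_bigr => s _; rewrite mulrBr.
rewrite sumrB tele sumrB; ring.
Qed.

(** The poles are the ends of the rows together with [- N - 1], and the zeros
are the ends of the rows minus 1.  A partition of size less than [N] has an empty
last row, whose zero is [- N - 1], so the extra pole carries no weight. *)
Lemma transition_prob_moments N (la : 'I_N -> nat) :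
  nonincreasing la -> (\sum_i la i < N)%N ->
  transition_moments (box_power_sum la)
    (fun k => \sum_i transition_prob la i * row_end la i ^+ k).
Proof.
move=> H laN; set t : rat := - N%:R - 1.
have rinj : injective (row_end la).
  by move=> i j; rewrite !row_endE => /addIr /(beta_inj H).
have rt i : row_end la i != t.
  rewrite row_endE -subr_eq0 /t opprD !opprK addrA subrK.
  by rewrite natr1 pnatr_eq0.
have [] := @interp_moment_recurrence _ _ (with_node t (row_end la))
  (fun j => row_end la j - 1) (with_node_inj rinj rt).
  by rewrite card_option.
have ipos : (0 < N)%N by apply: leq_ltn_trans laN.
have w0 : interp_weight (with_node t (row_end la)) (fun j => row_end la j - 1) None = 0.
  have lN : (N.-1 < N)%N by rewrite prednK.
  have la0 : la (Ordinal lN) = 0%N.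
    apply/eqP; rewrite -leqn0 leqNgt; apply/negP => lpos.
    move: laN; rewrite ltnNge => /negP; apply.
    rewrite -[X in (X <= _)%N]card_ord -sum1_card; apply: leq_sum => i _.
    apply: leq_trans lpos _; have /nonincreasingP := H; apply => /=.
    by have := ltn_ord i; lia.
  rewrite /interp_weight (bigD1 (Ordinal lN)) //= /row_end la0 /= prednK // /t.
  by rewrite mulr0n sub0r subrr !mul0r.
have wS i : interp_weight (with_node t (row_end la)) (fun j => row_end la j - 1) (Some i)
    = transition_prob la i.
  rewrite interp_weight_with_node mul1r /transition_prob row_endE.
  congr (_ / _); last by rewrite /t; ring.
  by apply: eq_bigr => j _; rewrite !row_endE; congr (_ / _); ring.
have mom k : \sum_o interp_weight (with_node t (row_end la)) (fun j => row_end la j - 1) o *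
     with_node t (row_end la) o ^+ k = \sum_i transition_prob la i * row_end la i ^+ k.
  by rewrite big_option /= w0 mul0r add0r; apply: eq_bigr => i _; rewrite wS.
move=> M0 Mrec; split; first by rewrite -mom.
move=> k; rewrite -mom Mrec; apply: eq_bigr => r _.
by rewrite mom big_option /= sum_transition_power.
Qed.

Definition rows N (la : N.-tuple 'I_N.+1) (i : 'I_N) : nat := tnth la i.

Definition partition_of N m (la : N.-tuple 'I_N.+1) : bool :=
  nonincreasing (rows la) && (\sum_i rows la i == m)%N.

Definition tuple_of_rows N (la : 'I_N -> nat) : N.-tuple 'I_N.+1 :=
  [tuple inord (la i) | i < N].

Lemma tuple_of_rowsK N (la : 'I_N -> nat) :
  (forall i, la i <= N)%N -> rows (tuple_of_rows la) = la.
Proof.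
by move=> laN; apply/funext => i; rewrite /rows tnth_mktuple inordK // ltnS.
Qed.

Lemma rowsK N : cancel (@rows N) (@tuple_of_rows N).
Proof. by move=> la; apply: eq_from_tnth => i; rewrite tnth_mktuple inord_val. Qed.

Lemma rows_le N (la : N.-tuple 'I_N.+1) i : (rows la i <= N)%N.
Proof. by rewrite /rows -ltnS. Qed.

(** The mean over partitions of [m] with at most [N] rows.  All partitions of [m]
occur as soon as [m <= N]; keeping [N] apart from [m] allows [m] to grow while
the number of rows is fixed. *)
Definition plancherel_mean N m (f : (nat -> rat) -> rat) : rat :=
  m`!%:R * \sum_(la | @partition_of N m la)
    frobenius (rows la) ^+ 2 * f (box_power_sum (rows la)).

Lemma partition_le N m (la : N.-tuple 'I_N.+1) i : partition_of m la -> (rows la i <= m)%N.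
Proof. by case/andP => _ /eqP <-; rewrite (bigD1 i) //= leq_addr. Qed.

Lemma sum_add_box N (la : 'I_N -> nat) i :
  (\sum_j add_box la i j = (\sum_j la j).+1)%N.
Proof.
rewrite big_split /= [X in (_ + X)%N](bigD1 i) //= eqxx.
rewrite [X in (_ + (_ + X))%N]big1 ?addn0 ?addn1 //.
by move=> j /negbTE ->.
Qed.

(** One of the two factors [frobenius mu] is expanded by the branching rule; the
pairs of a partition [mu] of size [m + 1] and a removable box are then counted
as pairs of a partition [la] of size [m] and an addable box.  The bound [m < N]
leaves room for a new row and keeps the rows of length at most [N]. *)
Lemma plancherel_mean_growth N m f : (m < N)%N ->
  plancherel_mean N m.+1 f = m`!%:R * \sum_(la | @partition_of N m la)
    frobenius (rows la) ^+ 2 *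
    \sum_i transition_prob (rows la) i * f (box_power_sum (add_box (rows la) i)).
Proof.
move=> mN; rewrite /plancherel_mean factS natrM.
rewrite [m.+1%:R * _]mulrC -mulrA mulr_sumr; congr (_ * _).
pose up i (la : N.-tuple 'I_N.+1) := tuple_of_rows (add_box (rows la) i).
pose down i (mu : N.-tuple 'I_N.+1) := tuple_of_rows (remove_box (rows mu) i).
have downE i mu : rows (down i mu) = remove_box (rows mu) i.
  by apply: tuple_of_rowsK => j; apply: leq_trans (leq_subr _ _) (rows_le _ _).
have upE i la : (forall j, rows la j <= m)%N -> rows (up i la) = add_box (rows la) i.
  move=> lam; apply: tuple_of_rowsK => j; rewrite /add_box.
  by have := lam j; case: (_ == _); lia.
pose G (mu la : N.-tuple 'I_N.+1) :=
  frobenius (rows mu) * f (box_power_sum (rows mu)) * frobenius (rows la).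
transitivity (\sum_(mu | @partition_of N m.+1 mu)
    \sum_(i | (0 < rows mu i)%N && nonincreasing (remove_box (rows mu) i)) G mu (down i mu)).
  apply: eq_bigr => mu /andP[nmu /eqP smu].
  rewrite /G -mulr_sumr; under eq_bigr do rewrite downE.
  by rewrite -frobenius_branching // smu; ring.
transitivity (\sum_(la | @partition_of N m la)
    \sum_(i | nonincreasing (add_box (rows la) i)) G (up i la) la); last first.
  apply: eq_bigr => la Hla; have /andP[nla _] := Hla.
  rewrite [in RHS]mulr_sumr big_mkcond; apply: eq_bigr => i _.
  rewrite /G upE; last by move=> j; apply: partition_le.
  have := frobenius_add_box i nla; rewrite -/(shift_weight _ 1 i) -/(transition_prob _ i).
  case: ifP => [_ ->|/negbT /(frobenius_add_box_eq0 nla) -> /esym/eqP]; first by ring.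
  rewrite mulf_eq0 => /orP[/eqP->|/eqP->]; first by rewrite expr0n !mul0r.
  by rewrite mul0r mulr0.
rewrite (exchange_big_dep xpredT) //= [RHS](exchange_big_dep xpredT) //=.
apply: eq_bigr => i _.
rewrite (reindex_onto (up i) (down i)) /=; last first.
  move=> mu /and3P[_ mui _]; rewrite /up downE -[RHS]rowsK; congr tuple_of_rows.
  apply/funext => j; rewrite /add_box /remove_box.
  by case: eqP => [->|]; lia.
apply: eq_big => [la|la].
  have [Hla|Hla] := boolP (partition_of m la).
    have /andP[nla /eqP sla] := Hla.
    have upla : rows (up i la) = add_box (rows la) i by apply/upE => j; apply: partition_le.
    have addK : remove_box (add_box (rows la) i) i = rows la.
      by apply/funext => j; rewrite /remove_box /add_box addnK.
    have downup : down i (up i la) = la by rewrite -[LHS]rowsK downE upla addK rowsK.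
    rewrite {1}/partition_of downup upla sum_add_box sla addK nla !eqxx !andbT.
    by rewrite {2}/add_box eqxx addn1 andbT.
  apply/negP => /andP[/and3P[/andP[_ /eqP smu] mui nmu] /eqP e].
  case/negP: Hla; rewrite -e /partition_of downE nmu.
  by rewrite (remove_box_sum mui smu) eqxx.
by case/andP => _ /eqP e; rewrite e.
Qed.

Lemma plancherel_mean0 N f : plancherel_mean N 0 f = f (fun=> 0).
Proof.
have zero_rows : rows (tuple_of_rows (fun _ : 'I_N => 0%N)) = fun=> 0%N.
  by apply: tuple_of_rowsK.
rewrite /plancherel_mean fact0 mul1r (big_pred1 (tuple_of_rows (fun=> 0%N))).
  rewrite zero_rows frobenius0 // expr1n mul1r; congr f.
  apply/funext => k; rewrite /box_power_sum big1 // => i _.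
  by rewrite /row_end mulr0n sub0r subrr.
move=> la; rewrite /partition_of; apply/andP/eqP => [[_]|->].
  rewrite sum_nat_eq0 => /forallP la0; rewrite -[la]rowsK; congr tuple_of_rows.
  by apply/funext => i; apply/eqP/(implyP (la0 i)).
rewrite zero_rows big1 //; split => //.
by apply/nonincreasingP.
Qed.

(** The probabilities add up to 1, their moment of order 0, so that the mean
value of [f] after one step is [f Q + g Q]. *)
Lemma plancherel_mean_increment N m f h g : (m < N)%N ->
  (forall Q a, f (shift_power_sums Q a) = f Q + h Q a) ->
  (forall (I : finType) (R a : I -> rat) Q,
    transition_moments Q (fun j => \sum_i R i * a i ^+ j) ->
    \sum_i R i * (a i ^+ 0 * h Q (a i)) = g Q) ->
  plancherel_mean N m.+1 f = plancherel_mean N m f + plancherel_mean N m g.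
Proof.
move=> mN fh hg; rewrite plancherel_mean_growth // /plancherel_mean -mulrDr -big_split /=.
congr (_ * _); apply: eq_bigr => la /andP[nla /eqP sla]; rewrite -mulrDr; congr (_ * _).
have HM : transition_moments (box_power_sum (rows la))
    (fun k => \sum_i transition_prob (rows la) i * row_end (rows la) i ^+ k).
  by apply: transition_prob_moments; rewrite ?sla.
rewrite -(hg _ _ _ _ HM); case: (HM) => M0 _.
rewrite -[f (box_power_sum (rows la))]mul1r -M0 mulr_suml -big_split /=.
apply: eq_bigr => i _; rewrite box_power_sum_add_box fh; ring.
Qed.

(** For a monomial of degree [d], start from ['X^(d.+1)]: its difference is
[(d + 1) x ^ d] plus terms of lower degree, which are summed by induction. *)
Lemma poly_antidifference (p : {poly rat}) : exists2 S : {poly rat},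
  S.[0] = 0 & forall x, S.[x + 1] - S.[x] = p.[x].
Proof.
have Hmon d : exists S : {poly rat}, forall x, S.[x + 1] - S.[x] = x ^+ d.
  elim/ltn_ind: d => d IH.
  have /choice[T HT] : forall j, exists S : {poly rat}, (j < d)%N ->
      forall x, S.[x + 1] - S.[x] = x ^+ j.
    move=> j; case: (boolP (j < d)%N) => [/IH[S HS]|_]; first by exists S.
    by exists 0.
  pose U : {poly rat} := \sum_(j < d) 'C(d.+1, j)%:R *: T j.
  have HU x : U.[x + 1] = \sum_(j < d) 'C(d.+1, j)%:R * x ^+ j + U.[x].
    rewrite !horner_sum -big_split /=; apply: eq_bigr => j _.
    by rewrite !hornerZ -mulrDr -(HT j (ltn_ord j) x) subrK.
  exists (d.+1%:R^-1 *: ('X^(d.+1) - U)) => x.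
  rewrite !hornerZ -mulrBr !hornerD !hornerN !hornerXn HU.
  have -> : (x + 1) ^+ d.+1 =
      \sum_(j < d) 'C(d.+1, j)%:R * x ^+ j + d.+1%:R * x ^+ d + x ^+ d.+1.
    rewrite addrC exprDn 2!big_ord_recr /= !expr1n !mul1r binn binSn mulr1n mulr_natl.
    congr (_ + _ + _).
    by apply: eq_bigr => j _; rewrite expr1n mul1r mulr_natl.
  apply: (@mulfI _ d.+1%:R); first by rewrite pnatr_eq0.
  rewrite mulrA mulfV ?pnatr_eq0 // mul1r; ring.
have /choice[T HT] := Hmon.
pose S := \sum_(j < size p) p`_j *: T j.
exists (S - (S.[0])%:P) => [|x]; first by rewrite !hornerE subrr.
rewrite !hornerE opprB addrA subrK [in RHS]horner_coef !horner_sum -sumrB.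
by apply: eq_bigr => j _; rewrite !hornerZ -mulrBr HT.
Qed.

(** The polynomial does not depend on [N], because neither the expected increment
[g] nor the value of [f] at the empty partition does. *)
Theorem plancherel_mean_polynomial w f : weight_le w f ->
  exists P : {poly rat}, forall N m, (m <= N)%N -> plancherel_mean N m f = P.[m%:R].
Proof.
elim/ltn_ind: w f => w IH f Hf.
suff [g [P HP step]] : exists g, exists2 P : {poly rat},
    (forall N m, (m <= N)%N -> plancherel_mean N m g = P.[m%:R]) &
    forall N m, (m < N)%N ->
      plancherel_mean N m.+1 f = plancherel_mean N m f + plancherel_mean N m g.
  have [S S0 HS] := poly_antidifference P.
  exists (S + (f (fun=> 0))%:P) => N m.
  elim: m => [|m IHm] mN; first by rewrite plancherel_mean0 !hornerE S0 add0r.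
  rewrite step // IHm ?(ltnW mN) // (HP N m (ltnW mN)) -HS -natr1 !hornerD !hornerC; ring.
have [h [Hh h0] fh] := weight_increment Hf.
case: w IH Hf Hh h0 => [|w] IH Hf Hh h0.
  exists (fun=> 0); exists 0 => [N m mN|N m mN].
    by rewrite horner0 /plancherel_mean big1 ?mulr0 // => la _; rewrite mulr0.
  apply: plancherel_mean_increment mN fh _ => I R a Q _.
  by rewrite h0 // big1 // => i _; rewrite !mulr0.
have [g Hg hg] := weight2_average Hh 0.
rewrite addn0 in Hg; have [P HP] := IH w (ltnSn w) g Hg.
exists g, P => // N m mN; exact: plancherel_mean_increment mN fh hg.
Qed.

(** * Symmetric functions and power sums *)

Definition is_subalgebra (X : Type) (C : (X -> rat) -> Prop) : Prop :=
  [/\ forall c, C (fun=> c),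
      forall f g, C f -> C g -> C (fun x => f x + g x) &
      forall f g, C f -> C g -> C (fun x => f x * g x)].

Lemma subalgebra_sum X (C : (X -> rat) -> Prop) : is_subalgebra C ->
  forall (I : Type) (r : seq I) (P : pred I) (F : I -> X -> rat),
  (forall i, P i -> C (F i)) -> C (fun x => \sum_(i <- r | P i) F i x).
Proof.
move=> [Cc CD _] I r P F CF; elim: r => [|i r IH].
  by under eq_fun do rewrite big_nil.
under eq_fun do rewrite big_cons.
by case Pi: (P i) => //; apply: CD (CF i Pi) IH.
Qed.

Definition power_sum (k : nat) (a : seq rat) : rat := \sum_(x <- a) x ^+ k.

(** The sum of [x_(i_1) ^ al_1 ... x_(i_l) ^ al_l] over distinct indices: a
multiple of the monomial symmetric function of [al] when the exponents are
positive, with a simpler product rule. *)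
Definition augmented_monomial (l : nat) (al : 'I_l -> nat) (a : seq rat) : rat :=
  \sum_(t : l.-tuple 'I_(size a) | uniq t) \prod_(j < l) a`_(tnth t j) ^+ al j.

(** In the product with a power sum the new index is either distinct from the
others or equal to one of them. *)
Lemma augmented_monomialS l (al : 'I_l.+1 -> nat) (a : seq rat) :
  augmented_monomial al a =
  power_sum (al ord0) a * augmented_monomial (fun j => al (lift ord0 j)) a -
  \sum_(s < l) augmented_monomial (fun j => al (lift ord0 j) + (j == s) * al ord0)%N a.
Proof.
pose w (t : l.-tuple 'I_(size a)) : rat := \prod_(j < l) a`_(tnth t j) ^+ al (lift ord0 j).
have -> : augmented_monomial al a =
    \sum_(i < size a) \sum_(t : l.-tuple 'I_(size a) | uniq t && (i \notin t))
      a`_i ^+ al ord0 * w t.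
  rewrite /augmented_monomial big_tuple_cons; apply: eq_bigr => i _.
  apply: eq_big => [t|t _] /=; first by rewrite andbC.
  rewrite big_ord_recl tnth0; congr (_ * _); apply: eq_bigr => j _.
  by rewrite tnthS.
have repeated : \sum_(i < size a) \sum_(t : l.-tuple 'I_(size a) | uniq t && (i \in t))
      a`_i ^+ al ord0 * w t =
    \sum_(s < l) augmented_monomial (fun j => al (lift ord0 j) + (j == s) * al ord0)%N a.
  rewrite (exchange_big_dep (fun t : l.-tuple _ => uniq t)) /=; last first.
    by move=> i t _ /andP[].
  rewrite [RHS]exchange_big; apply: eq_bigr => t ut /=.
  under eq_bigl do rewrite ut.
  rewrite -big_uniq // big_tuple; apply: eq_bigr => s _.
  rewrite /w (bigD1 s) //= [RHS](bigD1 s) //= eqxx mul1n exprD mulrA.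
  rewrite [_ * _ ^+ al ord0]mulrC.
  congr (_ * _); apply: eq_bigr => j /negbTE ->.
  by rewrite addn0.
apply/eqP; rewrite eq_sym subr_eq -repeated -big_split /=; apply/eqP.
rewrite /power_sum (big_nth 0) big_mkord mulr_suml; apply: eq_bigr => i _.
rewrite [RHS]addrC mulr_sumr (bigID (fun t : l.-tuple _ => i \in t)) //=.
Qed.

(** Power sums of exponent 0 are excluded: their value is the number of
variables. *)
Lemma augmented_monomial_subalgebra X (C : (X -> rat) -> Prop) (a : X -> seq rat) :
  is_subalgebra C ->
  (forall k, (0 < k)%N -> C (fun x => power_sum k (a x))) ->
  forall l (al : 'I_l -> nat), (forall j, (0 < al j)%N) ->
  C (fun x => augmented_monomial al (a x)).
Proof.
move=> HC Ca; have [Cc CD CM] := HC; elim=> [|l IH] al al_gt0.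
  have -> : (fun x => augmented_monomial al (a x)) = fun=> 1; last exact: Cc.
  apply/funext => x; rewrite /augmented_monomial (big_pred1 [tuple]) ?big_ord0 //.
  by move=> t; rewrite tuple0 /= eqxx.
under eq_fun do rewrite augmented_monomialS -mulN1r.
apply: CD; first by apply: CM; [apply: Ca | apply: IH => j].
apply: CM; first exact: Cc.
apply: subalgebra_sum => // s _; apply: IH => j.
by rewrite addn_gt0 al_gt0.
Qed.

Definition monomial (s : seq nat) : {cmonom nat} :=
  [cmonom nth 0%N s i | i in seq_fset tt (iota 0 (size s))]%M.

Lemma monomialE s i : monomial s i = nth 0%N s i.
Proof.
rewrite cmE fsfun_fun seq_fsetE mem_iota /= add0n.
by case: ltnP => // /(nth_default 0%N) ->.
Qed.

Lemma cmonom_supported (m : {cmonom nat}) (s : seq nat) :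
  (forall i, i \notin s -> m i = 0%N) -> {subset finsupp m <= s}.
Proof.
move=> m0 i; rewrite -cmE_neq0; apply: contraR => /m0 ->.
by [].
Qed.

Lemma big_cmonom (R : Type) (idx : R) (op : Monoid.com_law idx) (m : {cmonom nat})
    (s : seq nat) (F : nat -> R) : uniq s ->
  (forall i, i \notin s -> m i = 0%N) -> (forall i, m i = 0%N -> F i = idx) ->
  \big[op/idx]_(i <- finsupp m) F i = \big[op/idx]_(i <- s) F i.
Proof.
move=> us m0 F0; rewrite [RHS](bigID (fun i => i \in finsupp m)) /=.
rewrite [X in op _ X]big1 ?Monoid.mulm1 => [|i]; last first.
  by rewrite -cmE_eq0 => /eqP/F0.
rewrite -[RHS]big_filter; apply: perm_big; apply: uniq_perm => [||i].
- exact: fset_uniq.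
- exact: filter_uniq.
rewrite mem_filter; case mi: (i \in finsupp m) => //=.
by rewrite (cmonom_supported m0).
Qed.

Lemma monomial_out s i : i \notin iota 0 (size s) -> monomial s i = 0%N.
Proof. by rewrite mem_iota /= add0n -leqNgt monomialE => /(nth_default 0%N). Qed.

Lemma cmonom_eval_monomial N (a : seq rat) (e : N.-tuple nat) :
  cmonom_eval (nth 0 a) (monomial e) = \prod_(i < N) a`_i ^+ tnth e i.
Proof.
rewrite /cmonom_eval (big_cmonom _ (iota_uniq 0 (size e))); last first.
- by move=> i ->; rewrite expr0.
- exact: monomial_out.
rewrite size_tuple; transitivity (\prod_(0 <= i < N) a`_i ^+ monomial e i).
  by rewrite /index_iota subn0.
by rewrite big_mkord; apply: eq_bigr => i _; rewrite monomialE -tnth_nth.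
Qed.

Lemma mdeg_monomial N (e : N.-tuple nat) :
  mdeg (monomial e) = (\sum_(i < N) tnth e i)%N.
Proof.
rewrite /mdeg (big_cmonom _ (iota_uniq 0 (size e))) //; last exact: monomial_out.
rewrite size_tuple; transitivity (\sum_(0 <= i < N) monomial e i)%N.
  by rewrite /index_iota subn0.
by rewrite big_mkord; apply: eq_bigr => i _; rewrite monomialE -tnth_nth.
Qed.

Definition symmetric_coef (c : {cmonom nat} -> rat) : Prop :=
  forall s, bijective s -> forall m m' : {cmonom nat},
    (forall i, m' (s i) = m i) -> c m' = c m.

(** An injection of [0, ..., l - 1] into [0, ..., N - 1] extends to a permutation
of the natural numbers: list its values first, then the remaining numbers below
[N]. *)
Lemma uniq_tuple_bijection N l (t : l.-tuple 'I_N) : uniq t ->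
  exists2 s : nat -> nat, bijective s &
    [/\ forall j : 'I_l, s j = tnth t j,
        forall i, (l <= i < N)%N -> (s i < N)%N /\ s i \notin map val t &
        forall i, (N <= i)%N -> s i = i].
Proof.
move=> ut; pose T := map val t; pose L := T ++ [seq i <- iota 0 N | i \notin T].
have uT : uniq T by rewrite map_inj_uniq //; exact: val_inj.
have sT : size T = l by rewrite size_map size_tuple.
have TN i : i \in T -> (i < N)%N by case/mapP => j _ ->; apply: ltn_ord.
have uL : uniq L.
  rewrite cat_uniq uT filter_uniq ?iota_uniq // andbT; apply/hasPn => i.
  by rewrite mem_filter => /andP[].
have memL i : (i \in L) = (i < N)%N.
  rewrite mem_cat mem_filter mem_iota /= add0n.
  by case iT: (i \in T) => //=; rewrite TN.
have sL : size L = N.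
  rewrite -[RHS](size_iota 0); apply: perm_size; apply: uniq_perm => //.
    exact: iota_uniq.
  by move=> i; rewrite memL mem_iota.
have nthL i : (i < N)%N -> (nth 0%N L i < N)%N.
  by move=> iN; rewrite -memL mem_nth // sL.
exists (fun i => if (i < N)%N then nth 0%N L i else i).
  exists (fun i => if (i < N)%N then index i L else i) => i.
    by case: (ltnP i N) => [iN|]; [rewrite nthL // index_uniq // sL | rewrite ltnNge => ->].
  case: (ltnP i N) => [iN|]; last by rewrite ltnNge => ->.
  by rewrite -sL index_mem memL iN nth_index // memL.
split.
- move=> j; have lN : (l <= N)%N by rewrite -sL -sT size_cat leq_addr.
  rewrite (leq_trans (ltn_ord j) lN) nth_cat sT ltn_ord.
  rewrite (nth_map (tnth t j)) ?size_tuple //.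
  by rewrite -tnth_nth.
- move=> i /andP[li iN]; rewrite iN; split; first exact: nthL.
  rewrite nth_cat sT ltnNge li /=.
  have : nth 0%N [seq i <- iota 0 N | i \notin T] (i - l) \in [seq i <- iota 0 N | i \notin T].
    by rewrite mem_nth // -(ltn_add2l l) subnKC // -{1}sT -size_cat sL.
  by rewrite mem_filter => /andP[].
- by move=> i; rewrite leqNgt => /negbTE ->.
Qed.

(** A symmetric coefficient only sees the exponents, not the variables that carry
them. *)
Lemma symmetric_coef_spread c N l (t : l.-tuple 'I_N) (al : l.-tuple nat) (e : N.-tuple nat) :
  symmetric_coef c -> uniq t ->
  (forall j, tnth e (tnth t j) = tnth al j) ->
  (forall i, i \notin t -> tnth e i = 0%N) ->
  c (monomial e) = c (monomial al).
Proof.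
move=> Hc ut et e0; have [s sbij [s1 s2 s3]] := uniq_tuple_bijection ut.
have lN : (l <= N)%N.
  by rewrite -(size_tuple t) -(card_uniqP ut) -[X in (_ <= X)%N]card_ord max_card.
apply: (Hc s sbij) => i; rewrite !monomialE.
case: (ltnP i l) => [il|li].
  have -> : i = Ordinal il by [].
  by rewrite s1 -!tnth_nth et.
rewrite [RHS]nth_default ?size_tuple //; case: (ltnP i N) => [iN|Ni]; last first.
  by rewrite s3 // nth_default ?size_tuple.
have [siN sit] : (s i < N)%N /\ s i \notin map val t by apply: s2; rewrite li.
have -> : s i = Ordinal siN by [].
rewrite -tnth_nth e0 //; apply: contra sit => sit.
by apply/mapP; exists (Ordinal siN).
Qed.

Definition exponents N d (e : N.-tuple 'I_d) : N.-tuple nat := [tuple of map val e].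
Definition succ_exponents N d (e : N.-tuple 'I_d) : N.-tuple nat :=
  [tuple of map (fun i : 'I_d => i.+1) e].

(** A monomial with [l] variables is an arrangement of [l] positive exponents on
[l] distinct variables, in [l!] ways, one for each order of the variables. *)
Lemma symmetric_sum_augmented c d (a : seq rat) : symmetric_coef c ->
  (forall m, (d.+1 < mdeg m)%N -> c m = 0) ->
  \sum_(e : (size a).-tuple 'I_d.+2)
     c (monomial (exponents e)) * \prod_(i < size a) a`_i ^+ tnth e i =
  \sum_(l < d.+2) \sum_(al : l.-tuple 'I_d.+1)
     (l`!%:R^-1 * c (monomial (succ_exponents al))) *
     augmented_monomial (tnth (succ_exponents al)) a.
Proof.
move=> Hc cd; set N := size a.
pose H (e : N.-tuple 'I_d.+2) := c (monomial (exponents e)) * \prod_(i < N) a`_i ^+ tnth e i.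
pose supp (e : N.-tuple 'I_d.+2) : {set 'I_N} := [set i | tnth e i != ord0].
(* For a fixed ordered set [t] of variables, positive exponents on [t]
   correspond to monomials with support [t]. *)
have fixed_support l (t : l.-tuple 'I_N) : uniq t ->
    \sum_(al : l.-tuple 'I_d.+1) c (monomial (succ_exponents al)) *
       \prod_(j < l) a`_(tnth t j) ^+ tnth (succ_exponents al) j =
    \sum_(e | supp e == [set i in t]) H e.
  move=> ut.
  pose toE (al : l.-tuple 'I_d.+1) : N.-tuple 'I_d.+2 :=
    [tuple if i \in t then inord (nth 0%N (succ_exponents al) (index i t)) else ord0 | i < N].
  pose fromE (e : N.-tuple 'I_d.+2) : l.-tuple 'I_d.+1 :=
    [tuple inord (tnth e (tnth t j)).-1 | j < l].
  have indexK j : index (tnth t j) t = j.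
    by rewrite (tnth_nth (tnth t j)) index_uniq // size_tuple.
  have toE_in al j : tnth (toE al) (tnth t j) = (tnth al j).+1 :> nat.
    rewrite tnth_mktuple mem_tnth indexK -tnth_nth tnth_map inordK //.
    by rewrite ltnS ltn_ord.
  have toE_out al i : i \notin t -> tnth (toE al) i = ord0.
    by move=> it; rewrite tnth_mktuple (negbTE it).
  have supp_toE al : supp (toE al) = [set i in t].
    apply/setP => i; rewrite !inE; have [/tnthP[j ->]|it] := boolP (i \in t).
      by rewrite -(inj_eq val_inj) /= toE_in.
    by rewrite toE_out // eqxx.
  rewrite [RHS](reindex_onto toE fromE) => [|e /eqP/setP se]; last first.
    apply: eq_from_tnth => i; apply: val_inj.
    have := se i; rewrite !inE; have [/tnthP[j ->]|it] := boolP (i \in t).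
      rewrite -(inj_eq val_inj) /= toE_in tnth_mktuple; move: (tnth e _) => k k0.
      rewrite inordK ?prednK ?lt0n //.
      by have := ltn_ord k; move: k0; case: (k : nat).
    by rewrite toE_out // => /negbT; rewrite negbK => /eqP ->.
  apply: eq_big => [al|al _].
    rewrite supp_toE eqxx; apply/esym/eqP/eq_from_tnth => j.
    by apply: val_inj; rewrite /= tnth_mktuple toE_in inord_val.
  rewrite /H (symmetric_coef_spread (t := t) (al := succ_exponents al)) //.
  - congr (_ * _); rewrite [RHS](bigID (fun i => i \in t)) /=.
    rewrite [X in _ * X]big1 ?mulr1 => [|i it]; last by rewrite toE_out.
    rewrite -big_uniq // big_tuple; apply: eq_bigr => j _.
    by rewrite toE_in tnth_map.
  - by move=> j; rewrite [LHS]tnth_map [RHS]tnth_map /= toE_in.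
  - by move=> i it; rewrite tnth_map toE_out.
transitivity (\sum_(l < d.+2) \sum_(t : l.-tuple 'I_N | uniq t)
    \sum_(e | supp e == [set i in t]) l`!%:R^-1 * H e); last first.
  apply: eq_bigr => l _; under eq_bigr => t ut do rewrite -mulr_sumr -fixed_support // mulr_sumr.
  rewrite exchange_big /=; apply: eq_bigr => al _.
  by rewrite /augmented_monomial mulr_sumr; apply: eq_bigr => t _; rewrite mulrA.
under [RHS]eq_bigr => l _ do rewrite (exchange_big_dep xpredT) //=.
rewrite exchange_big; apply: eq_bigr => e _; rewrite -/(H e) /=.
set S := supp e.
(* The orders of the support of [e]. *)
have count l : #|(fun t : l.-tuple 'I_N => uniq t && (S == [set i in t]))| =
    (if l == #|S| then l`! else 0)%N.
  case: eqP => [lS|lS]; last first.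
    apply: eq_card0 => t; rewrite !unfold_in; apply/negP => /andP[ut /eqP St].
    by case: lS; rewrite St cardsE (card_uniqP ut) size_tuple.
  transitivity (#|S| ^_ l)%N; last by rewrite -lS ffactnn.
  rewrite -(card_uniq_tuples l (mem S)); apply: eq_card => t.
  rewrite [RHS]inE [LHS]unfold_in andbC; case ut: (uniq t); rewrite ?andbF //= !andbT.
  apply/eqP/allP => [-> i it|tS]; first by rewrite /= inE.
  suff tE : t =i S by apply/setP => i; rewrite [RHS]inE tE.
  apply: (elimT (subset_cardP _)).
  2: by rewrite subset_all; apply/allP.
  by rewrite (card_uniqP ut) size_tuple.
transitivity (\sum_(l < d.+2)
    (l`!%:R^-1 * H e) *+ (if l == #|S| :> nat then l`! else 0)); last first.
  by apply: eq_bigr => l _; rewrite -count -sumr_const; apply: eq_bigl.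
have [Sd|dS] := ltnP #|S| d.+2.
  rewrite (bigD1 (Ordinal Sd)) //= eqxx [X in _ + X]big1 ?addr0 => [|l lS]; last first.
    have {}lS : (l : nat) != #|S| by [].
    by rewrite (negbTE lS) mulr0n.
  by rewrite -mulrnAl -mulr_natr mulVf ?mul1r // pnatr_eq0 -lt0n fact_gt0.
rewrite [RHS]big1 => [|l _]; last first.
  by rewrite ifF ?mulr0n //; have := ltn_ord l; lia.
rewrite /H cd ?mul0r // (leq_trans dS) // (mdeg_monomial (exponents e)).
rewrite -sum1_card [X in (_ <= X)%N](bigID (fun i => i \in S)) /=.
rewrite (leq_trans _ (leq_addr _ _)) // leq_sum // => i.
by rewrite inE tnth_map -(inj_eq val_inj) /= lt0n.
Qed.

Lemma monomial_exponents_inj N d : injective (fun e : N.-tuple 'I_d => monomial (exponents e)).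
Proof.
move=> e e' /eqP/cmP ee'; apply: eq_from_tnth => i; apply: val_inj.
by have := ee' i; rewrite !monomialE -!tnth_nth !tnth_map.
Qed.

Lemma monomial_exponents_onto N d (m : {cmonom nat}) :
  (forall i, (N <= i)%N -> m i = 0%N) -> (mdeg m <= d)%N ->
  exists e : N.-tuple 'I_d.+1, m = monomial (exponents e).
Proof.
move=> mN md; exists [tuple inord (m i) | i < N]; apply/eqP/cmP => i.
rewrite monomialE; case: (ltnP i N) => [iN|Ni]; last first.
  by rewrite mN // nth_default // size_tuple.
have -> : i = Ordinal iN by [].
rewrite -tnth_nth tnth_map tnth_mktuple /= inordK // ltnS.
apply: leq_trans md; have [->//|mi] := eqVneq (m i) 0%N.
by rewrite mdegE (big_rem i) /= ?leq_addr // -cmE_neq0.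
Qed.

Lemma cmonom_eval_eq0 (a : seq rat) (m : {cmonom nat}) i :
  (size a <= i)%N -> m i != 0%N -> cmonom_eval (nth 0 a) m = 0.
Proof.
move=> ai mi; rewrite /cmonom_eval (big_rem i) /= -?cmE_neq0 //.
by rewrite nth_default // expr0n (negbTE mi) mul0r.
Qed.

Lemma bs_eval_exponents (G : bisymfun) d (a b : seq rat) :
  (forall m : monom2, (d < mdeg m.1 + mdeg m.2)%N -> G m = 0) ->
  bs_eval G a b =
  \sum_(e : (size a).-tuple 'I_d.+1) \sum_(e' : (size b).-tuple 'I_d.+1)
    G (monomial (exponents e), monomial (exponents e')) *
    (\prod_(i < size a) a`_i ^+ tnth e i) * \prod_(i < size b) b`_i ^+ tnth e' i.
Proof.
move=> Gd.
pose mon (p : (size a).-tuple 'I_d.+1 * (size b).-tuple 'I_d.+1) : monom2 :=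
  (monomial (exponents p.1), monomial (exponents p.2)).
have mon_inj : injective mon.
  by move=> [e1 e2] [e1' e2'] [] /monomial_exponents_inj -> /monomial_exponents_inj ->.
rewrite /bs_eval (fsbigE (map mon (index_enum _))) //=; first last.
- move=> m _ mr; have [md|] := leqP (mdeg m.1 + mdeg m.2) d;
    last by move=> /Gd ->; rewrite !mul0r.
  have [[i [ai mi]]|m1] := pselect (exists i, (size a <= i)%N /\ m.1 i != 0%N).
    by rewrite (cmonom_eval_eq0 ai mi) mulr0 mul0r.
  have [[i [bi mi]]|m2] := pselect (exists i, (size b <= i)%N /\ m.2 i != 0%N).
    by rewrite (cmonom_eval_eq0 bi mi) mulr0.
  have [e1 E1] : exists e : (size a).-tuple 'I_d.+1, m.1 = monomial (exponents e).
    apply: monomial_exponents_onto (leq_trans (leq_addr _ _) md) => i ai.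
    by apply/eqP/negP => /negP mi; apply: m1; exists i.
  have [e2 E2] : exists e : (size b).-tuple 'I_d.+1, m.2 = monomial (exponents e).
    apply: monomial_exponents_onto (leq_trans (leq_addl _ _) md) => i bi.
    by apply/eqP/negP => /negP mi; apply: m2; exists i.
  case/negP: mr; apply/mapP; exists (e1, e2); first exact: mem_index_enum.
  by rewrite /mon -E1 -E2; case: (m).
- by rewrite map_inj_uniq ?index_enum_uniq.
rewrite (eq_bigl xpredT) => [|m]; last by rewrite classical_sets.in_setT.
rewrite big_map pair_bigA /=; apply: eq_bigr => -[e1 e2] _ /=.
rewrite !cmonom_eval_monomial; congr (_ * _ * _); apply: eq_bigr => i _.
  by rewrite tnth_map.
by rewrite tnth_map.
Qed.

(** Expanding in both alphabets writes the value of [G] as a linear combination,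
with coefficients independent of [x], of products of augmented monomials. *)
Theorem bs_eval_subalgebra (G : bisymfun) X (C : (X -> rat) -> Prop) (a b : X -> seq rat) :
  is_subalgebra C ->
  (forall k, (0 < k)%N -> C (fun x => power_sum k (a x))) ->
  (forall k, (0 < k)%N -> C (fun x => power_sum k (b x))) ->
  C (fun x => bs_eval G (a x) (b x)).
Proof.
move=> HC Ca Cb; have [Cc CD CM] := HC; have [d Gd] := bs_bounded_degree G.
have Gd1 (m : monom2) : (d.+1 < mdeg m.1 + mdeg m.2)%N -> G m = 0.
  by move=> dm; apply: Gd; apply: leq_trans dm.
have sym1 m2 : symmetric_coef (fun m1 => G (m1, m2)).
  move=> s sbij m m' mm'.
  by apply: (bs_symmetric G sbij (inv_bij (fun _ : nat => erefl))).
have sym2 m1 : symmetric_coef (fun m2 => G (m1, m2)).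
  move=> s sbij m m' mm'.
  by apply: (bs_symmetric G (inv_bij (fun _ : nat => erefl)) sbij).
pose coef l (al : l.-tuple 'I_d.+1) l' (al' : l'.-tuple 'I_d.+1) : rat :=
  l'`!%:R^-1 * (l`!%:R^-1 * G (monomial (succ_exponents al), monomial (succ_exponents al'))).
have -> : (fun x => bs_eval G (a x) (b x)) = fun x =>
    \sum_(l < d.+2) \sum_(al : l.-tuple 'I_d.+1)
    \sum_(l' < d.+2) \sum_(al' : l'.-tuple 'I_d.+1)
      coef l al l' al' * augmented_monomial (tnth (succ_exponents al')) (b x) *
      augmented_monomial (tnth (succ_exponents al)) (a x).
  apply/funext => x; rewrite (bs_eval_exponents _ _ Gd1) exchange_big /=.
  under eq_bigr => e' _.
    rewrite -mulr_suml (symmetric_sum_augmented _ (sym1 (monomial (exponents e')))).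
    2: by move=> m dm; apply: Gd1; apply: leq_trans dm _; rewrite leq_addr.
  over.
  under eq_bigr => e' _ do rewrite mulr_suml.
  rewrite exchange_big /=; apply: eq_bigr => l _.
  under eq_bigr => e' _ do rewrite mulr_suml.
  rewrite exchange_big /=; apply: eq_bigr => al _.
  set c := fun m2 => l`!%:R^-1 * G (monomial (succ_exponents al), m2).
  transitivity ((\sum_(e' : (size (b x)).-tuple 'I_d.+2)
      c (monomial (exponents e')) * \prod_(i < size (b x)) (b x)`_i ^+ tnth e' i) *
      augmented_monomial (tnth (succ_exponents al)) (a x)).
    by rewrite mulr_suml; apply: eq_bigr => e' _; rewrite mulrAC.
  rewrite (symmetric_sum_augmented (c := c)); first last.
  - by move=> m dm; rewrite /c Gd1 ?mulr0 //; apply: leq_trans dm _; rewrite leq_addl.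
  - by move=> s sbij m m' mm'; rewrite /c (sym2 _ s sbij m m' mm').
  rewrite mulr_suml; apply: eq_bigr => l' _.
  by rewrite mulr_suml.
apply: subalgebra_sum => // l _; apply: subalgebra_sum => // al _.
apply: subalgebra_sum => // l' _; apply: subalgebra_sum => // al' _.
apply: (CM); last first.
  by apply: augmented_monomial_subalgebra => // j; rewrite tnth_map.
apply: CM; first exact: Cc.
by apply: augmented_monomial_subalgebra => // j; rewrite tnth_map.
Qed.

(** * Contents and shifted parts *)

Lemma subalgebra_horner X (C : (X -> rat) -> Prop) (p : {poly rat}) f :
  is_subalgebra C -> C f -> C (fun x => p.[f x]).
Proof.
move=> [Cc CD CM] Cf; elim/poly_ind: p => [|p c IH].
  by under eq_fun do rewrite horner0; apply: Cc.
under eq_fun do rewrite hornerMXaddC.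
by apply: CD; [apply: CM | apply: Cc].
Qed.

Definition weighted (g : (nat -> rat) -> rat) : Prop := exists w, weight_le w g.

Lemma weighted_subalgebra : is_subalgebra weighted.
Proof.
split=> [c|f g [v Hf] [w Hg]|f g [v Hf] [w Hg]].
- by exists 0%N; apply: weight_const.
- exists (v + w)%N; apply: weight_add.
    exact: weight_mono Hf (leq_addr _ _).
  exact: weight_mono Hg (leq_addl _ _).
- by exists (v + w)%N; apply: weight_mul.
Qed.

Lemma weighted_var k : weighted (fun Q => Q k).
Proof. by exists k.+1; apply: weight_var. Qed.

Lemma is_partitionE n (la : n.-tuple 'I_n.+1) : is_partition la = partition_of n la.
Proof.
rewrite /is_partition /partition_of; congr (_ && _).
have nthE (i : 'I_n) : nth 0%N [seq val p | p <- la] i = rows la i.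
  by rewrite (nth_map ord0) ?size_tuple // -tnth_nth.
rewrite sorted_pairwise; last by move=> x y z /= yx xz; apply: leq_trans xz yx.
apply/(pairwiseP 0%N)/nonincreasingP => [H i j|H i j].
  rewrite leq_eqVlt => /orP[/eqP/val_inj->//|ij].
  by rewrite -!nthE; apply: H; rewrite // inE size_map size_tuple.
rewrite !inE size_map size_tuple => iN jN ij.
by have := H (Ordinal iN) (Ordinal jN) (ltnW ij); rewrite -!nthE.
Qed.

Lemma num_SYT_frobenius n (la : n.-tuple 'I_n.+1) : partition_of n la ->
  (num_SYT la)%:R = n`!%:R * frobenius (rows la).
Proof.
move=> /andP[H /eqP sla]; rewrite -frobenius_formula // => [|i]; last exact: rows_le.
rewrite -(card_fillings_linext (@tableau_order_irr n)); last first.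
  by rewrite card_young // => i; apply: rows_le.
congr _%:R; apply: eq_card => f; rewrite !inE /is_SYT; congr (_ && _).
apply/andP/forallP => [[/forallP Hr /forallP Hc] u|Hf].
  apply/forallP => v; apply/implyP => /orP[uv|uv].
    by have /forallP/(_ v)/implyP/(_ uv) := Hr u.
  by have /forallP/(_ v)/implyP/(_ uv) := Hc u.
split; apply/forallP => u; apply/forallP => v; apply/implyP => uv;
  have /forallP/(_ v)/implyP := Hf u; apply; rewrite /tableau_order uv //.
by rewrite orbT.
Qed.

Lemma Psi_plancherel_mean n (G : bisymfun) f :
  (forall la : n.-tuple 'I_n.+1, partition_of n la ->
     bs_eval G (contents la) (shifted_parts la) = f (box_power_sum (rows la))) ->
  Psi n G = plancherel_mean n n f.
Proof.
move=> Gf; rewrite /Psi /plancherel_mean (eq_bigl _ _ (@is_partitionE n)) !mulr_sumr.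
apply: eq_bigr => la Hla; rewrite num_SYT_frobenius // Gf // exprMn.
rewrite (expr2 n`!%:R) -!mulrA mulKf //.
by rewrite pnatr_eq0 -lt0n fact_gt0.
Qed.

Lemma box_power_sum1 N (la : 'I_N -> nat) :
  box_power_sum la 1 = (\sum_i la i)%:R.
Proof.
rewrite natr_sum; apply: eq_bigr => i _.
by rewrite !expr1 /row_end opprK subrK.
Qed.

(** Polynomial functions of the ends of the rows, summed over the rows, are linear
combinations of the generators. *)
Lemma box_power_sum_horner N (la : 'I_N -> nat) (T : {poly rat}) :
  \sum_i (T.[row_end la i] - T.[- i.+1%:R]) = \sum_(r < size T) T`_r * box_power_sum la r.
Proof.
under [RHS]eq_bigr do rewrite mulr_sumr.
rewrite exchange_big; apply: eq_bigr => i _ /=; rewrite !horner_coef -sumrB.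
by apply: eq_bigr => r _; rewrite mulrBr.
Qed.

Lemma contents_power_sum n (la : n.-tuple 'I_n.+1) k :
  power_sum k (contents la) =
  \sum_(i < n) \sum_(j < rows la i) (j%:R - i%:R) ^+ k.
Proof.
rewrite /power_sum /contents big_map big_enum /=.
rewrite (eq_bigl (fun u : 'I_n * 'I_n => true && (u.2 < rows la u.1)%N)); last first.
  by move=> u; rewrite inE.
rewrite -(pair_big_dep xpredT (fun i j : 'I_n => (j < rows la i)%N)
                       (fun i j : 'I_n => (j%:R - i%:R) ^+ k)) /=.
apply: eq_bigr => i _.
by rewrite -(big_ord_widen n (fun j => (j%:R - i%:R) ^+ k) (rows_le la i)).
Qed.

(** The sum over a row telescopes to a difference of values of a polynomial, at
the end of the row and at the end of an empty row. *)
Lemma contents_power_sum_weighted k : exists2 g, weighted g &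
  forall n (la : n.-tuple 'I_n.+1),
    power_sum k (contents la) = g (box_power_sum (rows la)).
Proof.
have [S _ HS] := poly_antidifference 'X^k.
pose T := S \Po ('X + 1).
exists (fun Q => \sum_(r < size T) T`_r * Q r).
  have [Cc _ CM] := weighted_subalgebra.
  apply: (subalgebra_sum weighted_subalgebra) => r _.
  by apply: CM; [apply: Cc | apply: weighted_var].
move=> n la; rewrite contents_power_sum -box_power_sum_horner; apply: eq_bigr => i _.
rewrite /T !horner_comp !hornerD !hornerX !hornerC /row_end.
have -> : (rows la i)%:R - i.+1%:R + 1 = (rows la i)%:R - i%:R :> rat.
  by rewrite -natr1; ring.
have -> : - i.+1%:R + 1 = - i%:R :> rat by rewrite -natr1; ring.
elim: (rows la i) => [|m IH]; first by rewrite big_ord0 mulr0n sub0r subrr.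
rewrite big_ord_recr /= IH -[X in _ + X]hornerXn -HS -natr1.
by rewrite [m%:R + 1 - _]addrAC; ring.
Qed.

(** Since [la_i + n - i] is [n] plus the end of row [i], the binomial theorem
reduces the sum to the generators, powers of [n], and sums over empty rows, which
are polynomials in [n]; and [n] is the generator of index 1. *)
Lemma shifted_parts_power_sum_weighted k : exists2 g, weighted g &
  forall n (la : n.-tuple 'I_n.+1), partition_of n la ->
    power_sum k (shifted_parts la) = g (box_power_sum (rows la)).
Proof.
have /choice[U HU] : forall r, exists U : {poly rat}, forall n,
    U.[n%:R] = \sum_(i < n) (- i.+1%:R) ^+ r.
  move=> r; have [U U0 HU] := poly_antidifference ((- ('X + 1)) ^+ r).
  exists U; elim=> [|n IH]; first by rewrite big_ord0 U0.
  rewrite big_ord_recr /= -IH -natr1; apply/eqP; rewrite addrC -subr_eq HU.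
  by rewrite horner_exp hornerN hornerD hornerX hornerC natr1.
pose g r (Q : nat -> rat) := ('C(k, r)%:R *: 'X^(k - r)).[Q 1%N] * (Q r + (U r).[Q 1%N]).
exists (fun Q => \sum_(r < k.+1) g r Q).
  have [Cc CD CM] := weighted_subalgebra.
  apply: (subalgebra_sum weighted_subalgebra) => r _.
  apply: CM; first by apply: subalgebra_horner weighted_subalgebra _; apply: weighted_var.
  apply: CD; first exact: weighted_var.
  by apply: subalgebra_horner weighted_subalgebra _; apply: weighted_var.
move=> n la /andP[_ /eqP sla]; rewrite /g /power_sum /shifted_parts big_map big_enum /=.
rewrite box_power_sum1 sla.
transitivity (\sum_(i < n) \sum_(r < k.+1)
    'C(k, r)%:R * n%:R ^+ (k - r) * row_end (rows la) i ^+ r).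
  apply: eq_bigr => i _.
  have -> : (tnth la i + n - i.+1)%:R = n%:R + row_end (rows la) i :> rat.
    rewrite /row_end natrB ?natrD; first by rewrite /rows; ring.
    by rewrite (leq_trans (ltn_ord i)) // leq_addl.
  rewrite exprDn; apply: eq_bigr => r _.
  by rewrite -[LHS]mulr_natl mulrA.
rewrite exchange_big; apply: eq_bigr => r _ /=.
rewrite hornerZ hornerXn -mulr_sumr; congr (_ * _).
by rewrite HU /box_power_sum -big_split /=; apply: eq_bigr => i _; rewrite subrK.
Qed.

(** One function [g] has to serve for all sizes, so the subalgebra used consists of
functions on partitions of arbitrary size that agree with such a [g]. *)
Lemma bs_eval_weighted (G : bisymfun) : exists2 g, weighted g &
  forall n (la : n.-tuple 'I_n.+1), partition_of n la ->
    bs_eval G (contents la) (shifted_parts la) = g (box_power_sum (rows la)).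
Proof.
pose X := {n : nat & n.-tuple 'I_n.+1}.
pose C (F : X -> rat) := exists2 g, weighted g &
  forall n (la : n.-tuple 'I_n.+1), partition_of n la ->
    F (existT _ n la) = g (box_power_sum (rows la)).
have [Wc WD WM] := weighted_subalgebra.
have HC : is_subalgebra C.
  split=> [c|F F' [g Hg Fg] [g' Hg' Fg']|F F' [g Hg Fg] [g' Hg' Fg']].
  - by exists (fun=> c).
  - by exists (fun Q => g Q + g' Q); [apply: WD | move=> n la Hla; rewrite Fg // Fg'].
  - by exists (fun Q => g Q * g' Q); [apply: WM | move=> n la Hla; rewrite Fg // Fg'].
have Ccontents k : C (fun x => power_sum k (contents (projT2 x))).
  have [g Hg Eg] := contents_power_sum_weighted k.
  by exists g => // n la _; apply: Eg.
have Cshifted k : C (fun x => power_sum k (shifted_parts (projT2 x))).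
  have [g Hg Eg] := shifted_parts_power_sum_weighted k.
  by exists g => // n la; apply: Eg.
have [g Hg Gg] := bs_eval_subalgebra G HC (fun k _ => Ccontents k) (fun k _ => Cshifted k).
by exists g => // n la Hla; rewrite -Gg.
Qed.

Theorem theorem3p3 (G : bisymfun) :
  exists P : {poly rat}, forall n : nat, Psi n G = P.[n%:R].
Proof.
have [g [w Hg] Gg] := bs_eval_weighted G.
have [P HP] := plancherel_mean_polynomial Hg.
exists P => n; rewrite (Psi_plancherel_mean (Gg n)); exact: HP.
Qed.
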